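(* Let $K$ be an $R$-ball convex body in $\mathbb{R}^n$ such that $0\in\operatorname{int}(K)$ and $$\mu_K\left(\left\{x\in\partial K:\kappa_i(K,x)>\tfrac1R\text{ for all }i,\ 1\le i\le n-1\right\}\right)>0.$$ Let $P$ and $Q$ be the probability measures on $\partial K$ given by $dP=p\,w_K\,d\mu_K$ and $dQ=q\,w_K\,d\mu_K$, where $$p(x)=\frac{\kappa(K,x)}{\Omega_\infty^R(K)\,\langle x,N(x)\rangle^n},\qquad q(x)=\frac{\langle x,N(x)\rangle}{\Omega_0^R(K)},\qquad w_K(x)=\prod_{i=1}^{n-1}\left(1-\frac{1}{R\,\kappa_i(K,x)}\right)^{\frac{1}{n+1}}.$$ Then $$D_{KL}(P\|Q)=\log\left(\frac{\Omega_0^R(K)}{\Omega_\infty^R(K)}\,E^R(K)^{-\frac1n}\right).$$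
   Context: A convex body in $\mathbb{R}^n$ is a compact convex set with nonempty interior; $B^n_2$ is the closed Euclidean unit ball. For $R>0$, a convex body $K$ is $R$-ball convex if $K=\bigcap_{K\subset RB^n_2+x}(RB^n_2+x)$, i.e. it is the intersection of all closed balls of radius $R$ containing it. For $x\in\partial K$, $N(x)$ is the outer unit normal, $\kappa_i(K,x)$, $1\le i\le n-1$, are the principal curvatures (which exist almost everywhere on $\partial K$), $\kappa(K,x)=\prod_{i=1}^{n-1}\kappa_i(K,x)$ is the Gauss curvature, and $\mu_K$ is the surface area measure on $\partial K$. For $-\infty\le p\le\infty$, $p\neq-n$, the $L_p$-relative surface area of $K$ is $$\Omega_p^R(K)=\int_{\partial K}\left(\frac{\kappa(K,x)^{\frac{1}{n+1}}}{\langle x,N(x)\rangle}\right)^{\frac{n(p-1)}{n+p}}\prod_{i=1}^{n-1}\left(\kappa_i(K,x)-\frac1R\right)^{\frac{1}{n+1}}d\mu_K(x),$$ where for $p=\pm\infty$ the exponent $\frac{n(p-1)}{n+p}$ is read as $n$. For $K$ as in the claim, $$E^R(K)=\lim_{p\to\infty}\left(\frac{\Omega_p^R(K)}{\Omega_\infty^R(K)}\right)^{n+p}.$$ For probability measures $dP=\tilde p\,d\mu$ and $dQ=\tilde q\,d\mu$ absolutely continuous with respect to a measure $\mu$ on $X$, the Kullback-Leibler divergence is $D_{KL}(P\|Q)=\int_X\tilde p\log\frac{\tilde p}{\tilde q}\,d\mu$; here $X=\partial K$, $d\mu=w_K\,d\mu_K$, $\tilde p=p$ and $\tilde q=q$.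 *)

(* Defs.v *)
(* MathComp-Analysis *)
From HB Require Import structures.
From mathcomp Require Import all_boot all_order all_algebra.
From mathcomp Require Import all_classical all_reals all_analysis.

Set Implicit Arguments.
Unset Strict Implicit.
Unset Printing Implicit Defensive.

Import Order.TTheory GRing.Theory Num.Theory.
Import numFieldNormedType.Exports.

Local Open Scope classical_set_scope.
Local Open Scope ring_scope.

(* The norm that the library puts on ['rV[R]_n] is the sup norm: it is used
   below only through its (Euclidean) topology; lengths are measured by
   [enorm]. *)
Definition dot (R : realType) (n : nat) (x y : 'rV[R]_n) : R :=
  \sum_(i < n) x 0 i * y 0 i.

Definition enorm (R : realType) (n : nat) (x : 'rV[R]_n) : R :=
  Num.sqrt (dot x x).

Definition eball (R : realType) (n : nat) (c : 'rV[R]_n) (r : R) :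
    set 'rV[R]_n :=
  [set x | enorm (x - c) <= r].

Definition convex_body (R : realType) (n : nat) (K : set 'rV[R]_n) : Prop :=
  [/\ compact K, convex_set (K : set (convex_lmodType 'rV[R]_n))
    & interior K !=set0].

Definition ball_convex (R : realType) (n : nat) (r : R) (K : set 'rV[R]_n) :
    Prop :=
  K = \bigcap_(c in [set c | K `<=` eball c r]) eball c r.

Definition boundary (R : realType) (n : nat) (K : set 'rV[R]_n) :
    set 'rV[R]_n :=
  closure K `\` interior K.

Section Hausdorff.
Context (R : realType) (n : nat).
Local Open Scope ereal_scope.
Implicit Types (A : set 'rV[R]_n) (F : (set 'rV[R]_n)^nat).

(* Volume of the Euclidean unit ball of R^m, by the recursion
   v_(m+2) = 2 pi v_m / (m+2). *)
Fixpoint unit_ball_volume (m : nat) : R :=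
  match m with
  | 0 => 1%R
  | 1 => 2%R
  | m'.+2 => (2 * pi / m%:R * unit_ball_volume m')%R
  end.

(* [ediam set0 = -oo] *)
Definition ediam A : \bar R :=
  ereal_sup [set z | exists x y, [/\ A x, A y & z = (enorm (x - y))%:E]].

(* The case distinction matters only for m = 0, where 0 ^ 0 = 1 gives the
   counting measure. *)
Definition hausdorff_weight (m : nat) A : \bar R :=
  if `[< A = set0 >] then 0
  else (unit_ball_volume m / 2 ^+ m)%:E * ediam A ^+ m.

Definition hausdorff_pre (m : nat) (delta : R) A : \bar R :=
  ereal_inf [set \sum_(k <oo) hausdorff_weight m (F k) |
    F in [set F | A `<=` \bigcup_k F k /\
                  forall k, ediam (F k) <= delta%:E]].

(* m-dimensional Hausdorff outer measure, normalised so as to coincide with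
   Lebesgue measure when n = m. *)
Definition hausdorff (m : nat) A : \bar R :=
  ereal_sup [set hausdorff_pre m delta A | delta in [set d : R | (0 < d)%R]].

Definition surface_outer (K : set 'rV[R]_n) A : \bar R :=
  hausdorff n.-1 (A `&` boundary K).

Lemma unit_ball_volume_ge0 m : (0 <= unit_ball_volume m)%R.
Proof.
elim/ltn_ind: m => -[|[|m]] IH //=.
by rewrite mulr_ge0 ?IH// divr_ge0// mulr_ge0// pi_ge0.
Qed.

Lemma hausdorff_weight0 m : hausdorff_weight m set0 = 0.
Proof. by rewrite /hausdorff_weight asboolT. Qed.

Lemma hausdorff_weight_ge0 m A : 0 <= hausdorff_weight m A.
Proof.
rewrite /hausdorff_weight; case: asboolP => // /eqP/set0P[x Ax].
apply: mule_ge0.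
  by rewrite lee_fin divr_ge0 ?unit_ball_volume_ge0// exprn_ge0.
apply: expe_ge0; apply: (@le_trans _ _ (enorm (x - x))%:E).
  by rewrite lee_fin sqrtr_ge0.
by apply: ereal_sup_ubound; exists x, x.
Qed.

Let T := g_sigma_algebraType [set: set 'rV[R]_n].

Let weight m (delta : R) (A : set T) : \bar R :=
  if ediam A <= delta%:E then hausdorff_weight m A else +oo.

Let weight0 m delta : weight m delta set0 = 0.
Proof.
rewrite /weight (_ : ediam set0 = -oo) ?leNye ?hausdorff_weight0//.
rewrite /ediam (_ : [set z | _] = set0) ?ereal_sup0// -subset0.
by move=> z [x [y []]].
Qed.

Let weight_ge0 m delta A : 0 <= weight m delta A.
Proof. by rewrite /weight; case: ifP => // _; exact: hausdorff_weight_ge0. Qed.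

Let hausdorff_preE m delta :
  hausdorff_pre m delta = mu_ext (weight m delta : set T -> \bar R).
Proof.
apply/funext => A; apply/eqP; rewrite eq_le; apply/andP; split.
- apply: le_ereal_inf_tmp => _ [F [mF AF] <-].
  have [Fd|/existsNP[k /negP Fk]] :=
      pselect (forall k, ediam (F k) <= delta%:E).
    apply: ereal_inf_lbound; exists F => //.
    by apply: eq_eseriesr => k _; rewrite /weight Fd.
  by rewrite (eseries_pinfty _ _ (_ : weight m delta (F k) = +oo)) ?leey//;
    [move=> i _; rewrite -ltNye (lt_le_trans _ (weight_ge0 _ _ _))
    |rewrite /weight (negbTE Fk)].
- apply: le_ereal_inf_tmp => _ [F [AF Fd] <-].
  apply: ereal_inf_lbound; exists F.
    by split => // i; exact: sub_sigma_algebra.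
  by apply: eq_eseriesr => k _; rewrite /weight Fd.
Qed.

Lemma hausdorff_pre0 m delta : hausdorff_pre m delta set0 = 0.
Proof. by rewrite hausdorff_preE; apply: mu_ext0. Qed.

Lemma hausdorff_pre_ge0 m delta A : 0 <= hausdorff_pre m delta A.
Proof. by rewrite hausdorff_preE; apply: mu_ext_ge0. Qed.

Lemma le_hausdorff_pre m delta : {homo hausdorff_pre m delta :
  A B / A `<=` B >-> A <= B}.
Proof. by move=> A B AB; rewrite hausdorff_preE; exact: (@le_mu_ext _ T). Qed.

Lemma hausdorff_pre_sigma_subadditive m delta :
  sigma_subadditive (hausdorff_pre m delta).
Proof.
by move=> F; rewrite hausdorff_preE; exact: (@mu_ext_sigma_subadditive _ T).
Qed.

Lemma hausdorff0 m : hausdorff m set0 = 0.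
Proof.
apply/eqP; rewrite eq_le; apply/andP; split.
  by apply: ge_ereal_sup => _ [d _ <-]; rewrite hausdorff_pre0.
by apply: ereal_sup_ubound; exists 1%R => //=; rewrite hausdorff_pre0.
Qed.

Lemma hausdorff_ge0 m A : 0 <= hausdorff m A.
Proof.
apply: (le_trans (hausdorff_pre_ge0 m 1 A)).
by apply: ereal_sup_ubound; exists 1%R => /=.
Qed.

Lemma le_hausdorff m : {homo hausdorff m : A B / A `<=` B >-> A <= B}.
Proof.
move=> A B AB; apply: ge_ereal_sup => _ [d d0 <-].
apply: (le_trans (le_hausdorff_pre m d AB)).
by apply: ereal_sup_ubound; exists d.
Qed.

Lemma hausdorff_sigma_subadditive m : sigma_subadditive (hausdorff m).
Proof.
move=> F; apply: ge_ereal_sup => _ [d d0 <-].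
apply: (le_trans (hausdorff_pre_sigma_subadditive _ _ _)).
apply: lee_nneseries => [k _ _|k _]; first exact: hausdorff_pre_ge0.
by apply: ereal_sup_ubound; exists d.
Qed.

Section surface.
Variable K : set 'rV[R]_n.

Let surface_outer0 : surface_outer K set0 = 0.
Proof. by rewrite /surface_outer set0I hausdorff0. Qed.

Let surface_outer_ge0 A : 0 <= surface_outer K A.
Proof. exact: hausdorff_ge0. Qed.

Let le_surface_outer : {homo surface_outer K : A B / A `<=` B >-> A <= B}.
Proof. by move=> A B AB; apply: le_hausdorff; exact: setSI. Qed.

Let surface_outer_sigma_subadditive : sigma_subadditive (surface_outer K).
Proof.
move=> F; rewrite /surface_outer setI_bigcupl.
exact: hausdorff_sigma_subadditive.
Qed.

HB.instance Definition _ := isOuterMeasure.Build R _ (surface_outer K)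
  surface_outer0 surface_outer_ge0 le_surface_outer
  surface_outer_sigma_subadditive.

End surface.
End Hausdorff.

(* R^n with the sigma-algebra of the mu_K-measurable sets, which contains the
   Borel sets and every set disjoint from the boundary of K. *)
Definition surface_type (R : realType) (n : nat) (K : set 'rV[R]_n) :=
  caratheodory_type (surface_outer K).

(* The surface area measure mu_K on the boundary of K, as a measure on R^n
   carried by the boundary. *)
Definition surface_measure (R : realType) (n : nat) (K : set 'rV[R]_n) :
    set (surface_type K) -> \bar R :=
  surface_outer K.
Arguments surface_measure {R n} K A : rename.

HB.instance Definition _ (R : realType) (n : nat) (K : set 'rV[R]_n) :=
  isMeasure.Build _ (surface_type K) R (surface_measure K)
    (@caratheodory_measure0 _ _ (surface_outer K))
    (@caratheodory_measure_ge0 _ _ (surface_outer K))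
    (@caratheodory_measure_sigma_additive _ _ (surface_outer K)).

Section Curvature.
Context (R : realType) (n : nat).
Implicit Types (K : set 'rV[R]_n) (x : 'rV[R]_n).

(* At the boundary points with several outer unit normals, which form a
   mu_K-null set, one of them is chosen. *)
Definition outer_normal K x : 'rV[R]_n :=
  xget 0 [set u | enorm u = 1 /\ forall y, K y -> dot (y - x) u <= 0].

(* The rows of [E] are an orthonormal basis of the tangent hyperplane at [x].
   Near [x] the boundary of [K] is the graph of the function [f] measuring
   depth below the tangent hyperplane, and [A] is the second-order derivative
   of [f] at the origin in the sense of Alexandrov. *)
Definition second_fundamental_form K x (A : 'M[R]_n.-1) : Prop :=
  exists (E : 'M[R]_(n.-1, n)) (f : 'rV[R]_n.-1 -> R),
  [/\ A^T = A,
      E *m E^T = 1%:M,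
      E *m (outer_normal K x)^T = 0,
      \forall t \near (0 : 'rV[R]_n.-1),
        K (x + t *m E - f t *: outer_normal K x) /\
        forall s, K (x + t *m E - s *: outer_normal K x) -> f t <= s
    & forall e : R, 0 < e -> \forall t \near (0 : 'rV[R]_n.-1),
        `|f t - 2^-1 * dot (t *m A) t| <= e * enorm t ^+ 2].

(* The eigenvalues of the second fundamental form, with multiplicity and in
   nondecreasing order (hence independent of [E]). They exist mu_K-almost
   everywhere; the default value 0 is used elsewhere. *)
Definition principal_curvatures K x : 'rV[R]_n.-1 :=
  xget 0 [set k : 'rV[R]_n.-1 |
    (forall i j : 'I_n.-1, (i <= j)%N -> k 0 i <= k 0 j) /\
    exists2 A, second_fundamental_form K x A
             & char_poly A = \prod_(i < n.-1) ('X - (k 0 i)%:P)].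

Definition kappa_ K x (i : 'I_n.-1) : R := principal_curvatures K x 0 i.

Definition gauss_curvature K x : R := \prod_(i < n.-1) kappa_ K x i.

End Curvature.

Section RelativeSurfaceArea.
Context (R : realType) (n : nat).
Variables (r : R) (K : set 'rV[R]_n).

(* The exponent n (p - 1) / (n + p), equal to n for p = -oo, +oo. *)
Definition rel_exponent (p : \bar R) : R :=
  if p is p'%:E then n%:R * (p' - 1) / (n%:R + p') else n%:R.

Definition Omega (p : \bar R) : \bar R :=
  (\int[surface_measure K]_(x in boundary K)
    ((gauss_curvature K x `^ n.+1%:R^-1 / dot x (outer_normal K x))
       `^ rel_exponent p *
     \prod_(i < n.-1) (kappa_ K x i - r^-1) `^ n.+1%:R^-1)%:E)%E.

(* A limit in the extended reals; the value 0 is possible. *)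
Definition rel_E : \bar R :=
  lim (poweR (Omega p%:E / Omega +oo) (n%:R + p) @[p --> +oo%R])%E.

(* [fine] is harmless: Omega +oo and Omega 0 are finite and nonzero as soon as
   the densities below define probability measures. *)
Definition dens_p (x : 'rV[R]_n) : R :=
  gauss_curvature K x / (fine (Omega +oo%E) * dot x (outer_normal K x) ^+ n).

Definition dens_q (x : 'rV[R]_n) : R :=
  dot x (outer_normal K x) / fine (Omega 0%E).

Definition weight_w (x : 'rV[R]_n) : R :=
  \prod_(i < n.-1) (1 - (r * kappa_ K x i)^-1) `^ n.+1%:R^-1.

End RelativeSurfaceArea.

(* The set function f dmu. *)
Definition with_density d (T : measurableType d) (R : realType)
    (mu : set T -> \bar R) (f : T -> R) (A : set T) : \bar R :=
  (\int[mu]_(x in A) (f x)%:E)%E.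

(* Kullback-Leibler divergence, over X, of the measures with densities p, q
   with respect to mu. The conventions of [lne], of the extended division and
   of 0 * -oo = 0 give 0 log (0 / q) = 0 and p log (p / 0) = +oo for p > 0. *)
Definition KL d (T : measurableType d) (R : realType)
    (mu : set T -> \bar R) (X : set T) (p q : T -> R) : \bar R :=
  (\int[mu]_(x in X) ((p x)%:E * lne ((p x)%:E / (q x)%:E)))%E.

(* For s < 0 the library's [poweR] gives 0 to the power s = 0 and +oo to the
   power s = +oo; here these are +oo and 0. *)
Definition epow (R : realType) (x : \bar R) (s : R) : \bar R :=
  (if (s < 0)%R then (poweR x (- s))^-1 else poweR x s)%E.

(* Main.v *)
Require Import Defs.
From HB Require Import structures.
From mathcomp Require Import all_boot all_order all_algebra.
From mathcomp Require Import all_classical all_reals all_analysis.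
From mathcomp Require Import measurable_realfun complex ring lra.

Set Implicit Arguments.
Unset Strict Implicit.
Unset Printing Implicit Defensive.

Import Order.TTheory GRing.Theory Num.Theory.
Import numFieldNormedType.Exports.

Local Open Scope classical_set_scope.
Local Open Scope ring_scope.

(** With N = N(x) and a = kappa^(1/(n+1)) / <x,N>, the integrand of Omega_p is
psi * a^(-s), where psi = p w_K Omega_oo is the integrand of Omega_oo and
s = n(n+1)/(n+p) -> 0. Since (1 - a^(-s))/s increases to ln a as s decreases to
0, monotone convergence gives
  E^R(K) = exp (- n(n+1) (\int psi ln a) / Omega_oo),
which is 0 when the integral diverges. On the other hand
ln (p/q) = ln (Omega_0/Omega_oo) + (n+1) ln a, so that D_KL(P||Q) is
ln (Omega_0/Omega_oo) + (n+1) (\int psi ln a) / Omega_oo, possibly +oo.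

No almost-everywhere differentiability is needed: off the set where the second
fundamental form exists the default curvatures are 0, and every integrand
vanishes there. What has to be shown is that this set and the curvatures on it
are measurable, by approximation with rational quadratic forms, and that
R-ball convexity forces kappa_i >= 1/R there. *)

(** * Euclidean geometry of row vectors *)

(** The tangent hyperplane moves with x, so the second fundamental form A is carried by one
    symmetric n x n matrix M, equal to A on the tangent hyperplane and to a fixed scalar [lam] on
    the normal line. Approximation by rational M then makes sense without choosing frames, and the
    points with a given approximate M are cut out by projections of sigma-compact sets of tuples
    (point, normal, tangent vector, depth). Moreover (lam - c) times the product of the kappa_i - c
    is det(M - c I), so the Gauss curvature (c = 0) and the product in Omega_p (c = 1/R) are
    measurable without a measurable choice of eigenvalues. The analytic obstacle is that \int psi ln
    a may be infinite, so linearity has to be earned. P and Q having mass 1 makes Omega_oo and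
    Omega_0 finite and nonzero. Omega_0 is the moment s = n+1; it makes psi (1 - a^(-(n+1)))/(n+1)
    an integrable minorant of psi ln a, which excludes the value -oo. *)

Lemma natSinv_lt {R : realType} (d : R) : 0 < d -> exists k, k.+1%:R^-1 < d.
Proof.
by move=> d0; have [k _ kd] := near_infty_natSinv_lt (PosNum d0); exists k;
    exact: (kd k (leqnn k)).
Qed.

Section Euclidean.
Context {R : realType} {n : nat}.
Implicit Types (x y z : 'rV[R]_n) (a : R).

Lemma dotE x y : dot x y = (x *m y^T) 0 0.
Proof. by rewrite mxE; apply: eq_bigr => i _; rewrite mxE. Qed.

Lemma dotC x y : dot x y = dot y x.
Proof. by apply: eq_bigr => i _; rewrite mulrC. Qed.

Lemma dotDl x y z : dot (x + y) z = dot x z + dot y z.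
Proof. by rewrite !dotE mulmxDl mxE. Qed.

Lemma dotNl x z : dot (- x) z = - dot x z.
Proof. by rewrite !dotE mulNmx mxE. Qed.

Lemma dotZl a x z : dot (a *: x) z = a * dot x z.
Proof. by rewrite !dotE -scalemxAl mxE. Qed.

Lemma dot0l z : dot 0 z = 0.
Proof. by rewrite dotE mul0mx mxE. Qed.

Lemma dotBl x y z : dot (x - y) z = dot x z - dot y z.
Proof. by rewrite dotDl dotNl. Qed.

Lemma dotDr x y z : dot z (x + y) = dot z x + dot z y.
Proof. by rewrite dotC dotDl !(dotC z). Qed.

Lemma dotNr x z : dot z (- x) = - dot z x.
Proof. by rewrite dotC dotNl dotC. Qed.

Lemma dotBr x y z : dot z (x - y) = dot z x - dot z y.
Proof. by rewrite dotDr dotNr. Qed.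

Lemma dotZr a x z : dot z (a *: x) = a * dot z x.
Proof. by rewrite dotC dotZl dotC. Qed.

Lemma dot0r z : dot z 0 = 0.
Proof. by rewrite dotC dot0l. Qed.

Definition dot_lin := (dotDl, dotBl, dotNl, dotZl, dotDr, dotBr, dotNr, dotZr).

Lemma dot_ge0 x : 0 <= dot x x.
Proof. by apply: sumr_ge0 => i _; rewrite -expr2 sqr_ge0. Qed.

Lemma dot_eq0 x : dot x x = 0 -> x = 0.
Proof.
move=> /eqP; rewrite psumr_eq0 => [/allP h|i _]; last by rewrite -expr2 sqr_ge0.
apply/rowP => i; rewrite mxE; have := h i (mem_index_enum _).
by rewrite -expr2 sqrf_eq0 => /eqP.
Qed.

Lemma dot_Cauchy_Schwarz x y : dot x y ^+ 2 <= dot x x * dot y y.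
Proof.
have [->|y0] := eqVneq y 0; first by rewrite !dot0r mulr0 expr0n.
have yy : 0 < dot y y.
  by rewrite lt_neqAle dot_ge0 andbT eq_sym; apply/eqP => /dot_eq0/eqP; exact/negP.
have := dot_ge0 (dot y y *: x - dot x y *: y).
rewrite !dot_lin (dotC y x) => h.
have : 0 <= dot y y * (dot x x * dot y y - dot x y ^+ 2) by rewrite
    [leRHS](_ : _ = dot y y * (dot y y * dot x x) - dot x y * (dot y y * dot x y) - dot x y *
    (dot y y * dot x y - dot x y * dot y y)) //; [move: h; lra|ring].
by rewrite pmulr_rge0// subr_ge0.
Qed.

Lemma enorm_ge0 x : 0 <= enorm x.
Proof. exact: sqrtr_ge0. Qed.

Lemma enorm_sqr x : enorm x ^+ 2 = dot x x.
Proof. by rewrite sqr_sqrtr ?dot_ge0. Qed.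

Lemma enorm0 : enorm (0 : 'rV[R]_n) = 0.
Proof. by rewrite /enorm dot0l sqrtr0. Qed.

Lemma enorm_eq0 x : enorm x = 0 -> x = 0.
Proof. by move=> h; apply: dot_eq0; rewrite -enorm_sqr h expr0n. Qed.

Lemma enorm_gt0 x : x != 0 -> 0 < enorm x.
Proof.
by move=> x0; rewrite lt_neqAle enorm_ge0 andbT eq_sym; apply: contra_neq x0 => /enorm_eq0.
Qed.

Lemma enormN x : enorm (- x) = enorm x.
Proof. by rewrite /enorm !dot_lin opprK. Qed.

Lemma enormB x y : enorm (x - y) = enorm (y - x).
Proof. by rewrite -enormN opprB. Qed.

Lemma enormZ a x : enorm (a *: x) = `|a| * enorm x.
Proof. by rewrite /enorm !dot_lin mulrA -expr2 sqrtrM ?sqr_ge0// sqrtr_sqr. Qed.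

Lemma dot_le_enorm x y : `|dot x y| <= enorm x * enorm y.
Proof.
rewrite -(@ler_pXn2r _ 2)// ?nnegrE ?normr_ge0 ?mulr_ge0 ?enorm_ge0//.
by rewrite real_normK ?num_real// exprMn !enorm_sqr dot_Cauchy_Schwarz.
Qed.

Lemma enormD x y : enorm (x + y) <= enorm x + enorm y.
Proof.
rewrite -(@ler_pXn2r _ 2)// ?nnegrE ?addr_ge0 ?enorm_ge0//.
rewrite sqrrD !enorm_sqr !dot_lin (dotC y x).
have := le_trans (ler_norm _) (dot_le_enorm x y); rewrite -mulr_natl; lra.
Qed.

Lemma enorm_triangle z x y : enorm (x - y) <= enorm (x - z) + enorm (z - y).
Proof. by apply: le_trans (enormD _ _); rewrite addrA subrK. Qed.

Lemma coord_le_enorm x i : `|x 0 i| <= enorm x.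
Proof.
rewrite -(@ler_pXn2r _ 2)// ?nnegrE ?normr_ge0 ?enorm_ge0//.
rewrite real_normK ?num_real// enorm_sqr /dot (bigD1 i)//= expr2 lerDl.
by apply: sumr_ge0 => j _; rewrite -expr2 sqr_ge0.
Qed.

Lemma cvg_dot (T : Type) (F : set_system T) {FF : Filter F} (f g : T -> 'rV[R]_n) x y :
  f @ F --> x -> g @ F --> y -> (fun t => dot (f t) (g t)) @ F --> dot x y.
Proof.
have coord (h : T -> 'rV[R]_n) z i : h @ F --> z -> (fun t => h t 0 i) @ F --> z 0 i.
  by move=> hz; apply: (@continuous_cvg _ _ _ F FF h (fun v : 'rV[R]_n => v 0 i)) => //;
    exact: coord_continuous.
move=> fx gy; apply: cvg_big => [|i _]; first exact: add_continuous.
by apply: cvgM; exact: coord.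
Qed.

Lemma cvg_enorm (T : Type) (F : set_system T) {FF : Filter F} (f : T -> 'rV[R]_n) x :
  f @ F --> x -> (fun t => enorm (f t)) @ F --> enorm x.
Proof.
by move=> fx; apply: (@continuous_cvg _ _ _ _ _ (fun t => dot (f t) (f t)) Num.sqrt);
  [exact: sqrt_continuous|exact: cvg_dot].
Qed.

(** Coordinates are bounded by the Euclidean norm, and the Euclidean norm is continuous for the
    sup-norm topology; hence both norms have the same neighbourhoods. *)
Lemma nbhs_enormP x (P : set 'rV[R]_n) :
  nbhs x P <-> exists2 d : R, 0 < d & forall y, enorm (y - x) < d -> P y.
Proof.
split=> [/nbhs_ballP[e /= e0 xP]|[d d0 xP]].
  exists e => // y yx; apply: xP; split=> [//|i j].
  rewrite /ball/= ord1 distrC.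
  by apply: le_lt_trans yx; have := coord_le_enorm (y - x) j; rewrite !mxE.
have : (fun y => enorm (y - x)) @ nbhs x --> (0 : R).
  by rewrite -[in X in _ --> X]enorm0 -(subrr x); apply: cvg_enorm; apply: cvgB;
      [exact: cvg_id|exact: cvg_cst].
move=> /cvgrPdist_lt/(_ d d0); apply: filterS => y.
by rewrite sub0r normrN ger0_norm ?enorm_ge0// => /xP.
Qed.

End Euclidean.

(** * Measurability for the surface measure *)

Section MetricOuterMeasure.
Context {R : realType} {n : nat}.
Local Open Scope ereal_scope.
Implicit Types (A B C X : set 'rV[R]_n) (mu : {outer_measure set 'rV[R]_n -> \bar R}).

Definition separated A B (d : R) := forall a b, A a -> B b -> (d <= enorm (a - b))%R.

(** Caratheodory's criterion for an outer measure to measure all closed sets; the reverse inequality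
    is subadditivity. *)
Definition metric_outer_measure mu := forall A B (d : R), (0 < d)%R ->
  separated A B d -> mu A + mu B <= mu (A `|` B).

(** A set of diameter at most delta < d cannot meet both A and B, so each cover of the union splits
    into a cover of A and a cover of B. *)
Lemma hausdorff_pre_separated m delta A B (d : R) : (delta < d)%R ->
  separated A B d ->
  hausdorff_pre m delta A + hausdorff_pre m delta B
    <= hausdorff_pre m delta (A `|` B).
Proof.
move=> deltad AB; apply: le_ereal_inf_tmp => _ [F [ABF Fd] <-].
(* Pieces missing D become empty: weight 0, diameter -oo. *)
pose restr D k := if `[< F k `&` D !=set0 >] then F k else set0.
have ediam0 : ediam (set0 : set 'rV[R]_n) = -oo.
  by rewrite /ediam (_ : [set z | _] = set0) ?ereal_sup0// -subset0 => z [x [y []]].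
have cover D : D `<=` A `|` B ->
    hausdorff_pre m delta D <= \sum_(k <oo) hausdorff_weight m (restr D k).
  move=> DAB; apply: ereal_inf_lbound; exists (restr D) => //; split.
    move=> x Dx; have [k _ Fkx] := ABF _ (DAB _ Dx); exists k => //.
    by rewrite /restr; case: asboolP => // -[]; exists x.
  by move=> k; rewrite /restr; case: asboolP => [_|_]; rewrite ?Fd// ediam0 leNye.
apply: le_trans (leeD (cover A _) (cover B _)) _; [exact: subsetUl|exact: subsetUr|].
rewrite -nneseriesD; try by move=> i _ _; exact: hausdorff_weight_ge0.
apply: lee_nneseries => [k _ _|k _]; first by rewrite adde_ge0 ?hausdorff_weight_ge0.
rewrite /restr; case: asboolP => [[a [Fa Aa]]|_]; case: asboolP => [[b [Fb Bb]]|_];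
  rewrite ?hausdorff_weight0 ?adde0 ?add0e ?hausdorff_weight_ge0//.
exfalso; have : (enorm (a - b))%:E <= delta%:E.
  by apply: le_trans (Fd k); apply: ereal_sup_ubound; exists a, b.
by rewrite lee_fin leNgt (lt_le_trans deltad (AB _ _ Aa Bb)).
Qed.

Lemma le_hausdorff_pre_delta m (d e : R) A : (e <= d)%R ->
  hausdorff_pre m d A <= hausdorff_pre m e A.
Proof.
move=> ed; apply: ereal_inf_le_tmp => _ [F [AF Fe] <-]; exists F => //; split => // k.
by apply: le_trans (Fe k) _; rewrite lee_fin.
Qed.

Lemma hausdorff_separated m A B (d : R) : (0 < d)%R -> separated A B d ->
  hausdorff m A + hausdorff m B <= hausdorff m (A `|` B).
Proof.
move=> d0 AB; have [->|] := eqVneq (hausdorff m (A `|` B)) +oo; first exact: leey.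
rewrite -ltey => fAB.
have fin D : D `<=` A `|` B -> hausdorff m D \is a fin_num.
  move=> DAB; rewrite ge0_fin_numE ?hausdorff_ge0//.
  by apply: le_lt_trans fAB; exact: le_hausdorff.
have fpre D e : (0 < e)%R -> D `<=` A `|` B -> hausdorff_pre m e D \is a fin_num.
  move=> e0 DAB; rewrite ge0_fin_numE ?hausdorff_pre_ge0//.
  apply: le_lt_trans fAB; apply: le_trans (le_hausdorff_pre m e DAB) _.
  by apply: ereal_sup_ubound; exists e.
rewrite -leeBrDr ?fin//; apply: ge_ereal_sup => _ [d1 d10 <-].
rewrite leeBrDr ?fin// addeC -leeBrDr; last by apply: fpre => //; exact: subsetUl.
apply: ge_ereal_sup => _ [d2 d20 <-].
rewrite leeBrDr; last by apply: fpre => //; exact: subsetUl.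
(* Being below d1 and d2 only increases the premeasures, and being below d separates A from B. *)
pose e := Num.min (Num.min d1 d2) (d / 2)%R.
have e0 : (0 < e)%R by rewrite !lt_min d10 d20 divr_gt0.
rewrite addeC; apply: (@le_trans _ _ (hausdorff_pre m e A + hausdorff_pre m e B)).
  by apply: leeD; apply: le_hausdorff_pre_delta; rewrite !ge_min lexx ?orbT.
apply: le_trans (hausdorff_pre_separated _ _ AB) _.
  by rewrite gt_min [X in _ || X](_ : _ = true) ?orbT//; lra.
by apply: ereal_sup_ubound; exists e.
Qed.

Lemma surface_outer_metric K : metric_outer_measure (surface_outer K).
Proof.
move=> A B d d0 AB; rewrite /= /surface_outer setIUl.
by apply: (hausdorff_separated _ d0) => a b [Aa _] [Bb _]; exact: AB.
Qed.

(* The distance shells around C two steps apart are separated, so their masses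
   sum to at most 2 mu X and the mass of X near C (but off C) tends to 0. *)
Lemma closed_caratheodory mu C : metric_outer_measure mu -> closed C ->
  mu.-caratheodory C.
Proof.
move=> mum cC; apply: le_caratheodory_measurable => X.
have [->|] := eqVneq (mu X) +oo; first exact: leey.
rewrite -ltey => fX.
pose A k := [set x | X x /\ forall c, C c -> (k.+1%:R^-1 <= enorm (x - c))%R].
pose S k := A k.+1 `\` A k.
have muA k : mu (A k) <= mu X by apply: le_outer_measure => x [].
have step N : mu (S N.+1) + mu (A N) <= mu (A N.+2).
  apply: (@le_trans _ _ (mu (S N.+1 `|` A N))); last first.
    apply: le_outer_measure => x [[]//|[Xx xC]]; split=> // c Cc.
    by apply: (le_trans _ (xC c Cc)); rewrite lef_pV2 ?posrE ?ltr0n// ler_nat ltnS leqW.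
  (* A point of the shell [S N.+1] is closer than 1/(N+2) to some c in C, while points of [A N] stay
     1/(N+1) away from c. *)
  apply: (mum _ _ (N.+1%:R^-1 - N.+2%:R^-1)%R).
    by rewrite subr_gt0 ltf_pV2 ?posrE ?ltr0n// ltr_nat.
  move=> a b [[Xa _] Aa] [Xb Ab].
  have [c [Cc ac]] : exists c, C c /\ (enorm (a - c) < N.+2%:R^-1)%R.
    apply: contrapT => h; apply: Aa; split=> // c Cc; rewrite leNgt.
    by apply/negP => ac; apply: h; exists c.
  have := Ab c Cc; have := enorm_triangle a b c; rewrite (enormB b a); move: ac;
      set p := N.+1%:R^-1%R; set q := N.+2%:R^-1%R; lra.
(* Each [step] jumps by two, so the even and the odd shells telescope separately, into the two terms
   on the right. *)
have sumS N : \sum_(0 <= k < N.+1) mu (S k) <= mu (A N.+1) + mu (A N).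
  elim: N => [|N IH]; first by rewrite big_nat1 -[leLHS]adde0 leeD ?outer_measure_ge0//
      le_outer_measure// => x [].
  rewrite big_nat_recr//=; apply: le_trans (leeD IH (lexx _)) _.
  by rewrite -addeA addeC leeD2r// addeC step.
have sum_fin : \sum_(0 <= k <oo) mu (S k) < +oo.
  apply: (@le_lt_trans _ _ (mu X + mu X)); last by rewrite lte_add_pinfty.
  apply: lime_le; first by apply: is_cvg_nneseries => k _ _; exact: outer_measure_ge0.
  apply: nearW => -[|N]; first by rewrite big_geq// adde_ge0 ?outer_measure_ge0.
  by apply: le_trans (sumS N) _; rewrite leeD.
have tail := nneseries_tail_cvg sum_fin (fun k _ => outer_measure_ge0 mu (S k)).
have bound N : mu (X `&` C) + mu (X `&` ~` C) <= mu X + \sum_(N <= k <oo) mu (S k).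
  apply: (@le_trans _ _ (mu (X `&` C) + (mu (A N) + \sum_(N <= k <oo) mu (S k)))).
    rewrite leeD2l//; apply: le_trans
        (leeD (lexx _) (outer_measure_sigma_subadditive_tail mu N S)).
    apply: (le_trans _ (outer_measureU2 _ _ _)).
    apply: le_outer_measure => x [Xx Cx].
    have [k Ak] : exists k, A k x.
      have : nbhs x (~` C) by apply: open_nbhs_nbhs; split=> //; exact: closed_openC.
      move=> /nbhs_enormP[d d0 xd].
      have [k kd] := natSinv_lt d0.
      exists k; split=> // c Cc; rewrite leNgt; apply/negP => h.
      apply: (xd c) Cc; by rewrite enormB (lt_trans h).
    have [ANx|ANx] := pselect (A N x); [by left|right].
    elim: k Ak => [|k IH] Ak.
      exfalso; apply: ANx; split=> // c /(Ak.2 c); apply: le_trans.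
      by rewrite lef_pV2 ?posrE ?ltr0n// ler_nat.
    have [/IH//|nAk] := pselect (A k x).
    exists k; last by split.
    move=> /= kN; apply: ANx; split=> // c /(Ak.2 c); apply: le_trans.
    by rewrite lef_pV2 ?posrE ?ltr0n// ler_nat.
  rewrite addeA leeD2r//; apply: (@le_trans _ _ (mu ((X `&` C) `|` A N))).
    apply: (mum _ _ N.+1%:R^-1%R); first by rewrite invr_gt0.
    by move=> a b [_ Ca] [_ /(_ a Ca)]; rewrite enormB.
  by apply: le_outer_measure => x [[]|[]].
have lim : mu X + \sum_(N <= k <oo) mu (S k) @[N --> \oo] --> mu X.
  rewrite -[X in _ --> X]adde0; apply: cvgeD => //; last exact: cvg_cst.
  by rewrite fin_num_adde_defl.
rewrite -(cvg_lim _ lim)//; apply: lime_ge; first exact: cvgP lim.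
exact: nearW.
Qed.

Lemma compact_surface_measurable (K : set 'rV[R]_n) C : compact C ->
  measurable (C : set (surface_type K)).
Proof.
move=> cC; apply: (@closed_caratheodory (surface_outer K)).
  exact: surface_outer_metric.
by apply: compact_closed => //; exact: norm_hausdorff.
Qed.

End MetricOuterMeasure.

(** * Countable unions of closed sets and their projections *)

Section Topology.
Context {T : topologicalType} {R : realType}.

Lemma closed_le_continuous (f g : T -> R) : continuous f -> continuous g ->
  closed [set p | f p <= g p].
Proof.
move=> cf cg; rewrite (_ : [set p | _] = (fun p => g p - f p) @^-1` [set y | 0 <= y]); last first.
  by apply/seteqP; split => p /=; rewrite subr_ge0.
apply: preimage_closed; last exact: closed_ge.
by move=> p _; apply: cvgB; [exact: cg|exact: cf].
Qed.

Lemma closed_eq_continuous (f g : T -> R) : continuous f -> continuous g ->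
  closed [set p | f p = g p].
Proof.
move=> cf cg; rewrite (_ : [set p | _] = [set p | f p <= g p] `&` [set p | g p <= f p]).
  by apply: closedI; exact: closed_le_continuous.
by apply/seteqP; split => p /= => [->//|[fg gf]]; apply/eqP; rewrite eq_le fg gf.
Qed.

Lemma open_lt_continuous (f g : T -> R) : continuous f -> continuous g ->
  open [set p | f p < g p].
Proof.
move=> cf cg; rewrite (_ : [set p | _] = ~` [set p | g p <= f p]).
  by apply: closed_openC; exact: closed_le_continuous.
by apply/seteqP; split => p /=; rewrite ltNge => /negP.
Qed.

(** An arbitrary countable index type lets an intersection be indexed by pairs. *)
Definition Fsigma (A : set T) :=
  exists (I : countType) (F : I -> set T),
    (forall i, closed (F i)) /\ A = \bigcup_i F i.

Lemma closed_Fsigma (A : set T) : closed A -> Fsigma A.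
Proof. move=> cA; exists unit, (fun=> A); split => //.
by apply/seteqP; split => [x Ax|x [_ _ //]]; exists tt.
Qed.

Lemma FsigmaI (A B : set T) : Fsigma A -> Fsigma B -> Fsigma (A `&` B).
Proof.
move=> [I [F [cF ->]]] [J [G [cG ->]]].
exists (I * J)%type, (fun ij => F ij.1 `&` G ij.2); split.
  by move=> ij; exact: closedI.
apply/seteqP; split => [p [[i _ Fi] [j _ Gj]]|p [[i j] _ [Fi Gj]]]; first by exists (i, j).
by split; [exists i|exists j].
Qed.

End Topology.

(** The points whose 1/(k+1)-ball lies in A exhaust A; a point of their closure is within 1/(k+1) of
    one of them, hence still in A. *)
Lemma open_Fsigma {R : realType} {T : pseudoMetricType R} (A : set T) : open A -> Fsigma A.
Proof.
move=> oA; exists nat, (fun k => closure [set x | ball x (k.+1%:R^-1 : R) `<=` A]); split.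
  by move=> k; exact: closed_closure.
apply/seteqP; split => [x Ax|x [k _ xk]].
  have /nbhs_ballP[d /= d0 xd] : nbhs x A by exact: open_nbhs_nbhs.
  have [k kd] := natSinv_lt d0.
  exists k => //; apply: subset_closure => /=; apply: subset_trans xd.
  by apply: le_ball; exact: ltW.
have [y [/= yA xy]] := xk _ (nbhsx_ballx x (k.+1%:R^-1 : R) ltac:(by rewrite invr_gt0)).
by apply: yA; exact: ball_sym.
Qed.

Section Projection.
Context {R : realType} {n : nat} (K : set 'rV[R]_n).

Lemma compact_image {T U : topologicalType} (f : T -> U) (A : set T) :
  continuous f -> compact A -> compact (f @` A).
Proof. by move=> cf; apply: continuous_compact; exact: continuous_subspaceT. Qed.

(** Projections of closed sets need not be measurable in an elementary way; inside a compact set C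
    the closed pieces are compact, and so are their images. *)
Lemma Fsigma_image_measurable {T : topologicalType} (f : T -> 'rV[R]_n) (A C : set T) :
  continuous f -> compact C -> A `<=` C -> Fsigma A ->
  measurable (f @` A : set (surface_type K)).
Proof.
move=> cf cC AC [I [F [cF AF]]].
rewrite (_ : f @` A = \bigcup_i (f @` (C `&` F i))).
  apply: countable_bigcupT_measurable => // i; apply: compact_surface_measurable.
  by apply: compact_image => //; exact: compact_closedI.
rewrite -image_bigcup -setI_bigcupr -AF; congr (_ @` _).
by rewrite setIC; exact/esym/setIidl.
Qed.

Lemma enorm_ball_compact (r : R) : compact [set x : 'rV[R]_n | enorm x <= r].
Proof.
apply: bounded_closed_compact.
  exists r; split; first exact: num_real.
  move=> b rb x /= xr; apply: le_trans (ltW rb); apply: le_trans xr.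
  rewrite [leLHS]/Num.norm /= mx_normrE; apply/bigmax_leP; split=> [|[i j] _ /=].
    exact: enorm_ge0.
  by rewrite ord1; exact: coord_le_enorm.
apply: closed_le_continuous; last exact: cst_continuous.
by move=> x; apply: (@cvg_enorm _ _ _ (nbhs x) _ id); exact: cvg_id.
Qed.

End Projection.

Section ContinuousVector.
Context {R : realType} {n : nat} {T : topologicalType}.
Implicit Types (f g : T -> 'rV[R]_n).

Lemma continuous_dot f g : continuous f -> continuous g ->
  continuous (fun t => dot (f t) (g t)).
Proof. by move=> cf cg t; apply: cvg_dot; [exact: cf|exact: cg]. Qed.

Lemma continuous_enorm f : continuous f -> continuous (fun t => enorm (f t)).
Proof. by move=> cf t; apply: cvg_enorm; exact: cf. Qed.

Lemma continuous_addv f g : continuous f -> continuous g ->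
  continuous (fun t => f t + g t).
Proof. by move=> cf cg t; apply: cvgD; [exact: cf|exact: cg]. Qed.

Lemma continuous_subv f g : continuous f -> continuous g ->
  continuous (fun t => f t - g t).
Proof. by move=> cf cg t; apply: cvgB; [exact: cf|exact: cg]. Qed.

Lemma continuous_scalev (a : T -> R) f : continuous a -> continuous f ->
  continuous (fun t => a t *: f t).
Proof. by move=> ca cf t; apply: cvgZ; [exact: ca|exact: cf]. Qed.

Lemma continuous_mulmx (M : 'M[R]_n) f : continuous f -> continuous (fun t => f t *m M).
Proof.
move=> cf t; rewrite /continuous_at mulmx_sum_row.
rewrite (_ : (fun t => f t *m M) = (fun t => \sum_i f t 0 i *: row i M)); last first.
  by apply/funext => t'; rewrite mulmx_sum_row.
apply: cvg_big => [|i _]; first exact: add_continuous.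
apply: cvgZ; last exact: cvg_cst.
by apply: (@continuous_cvg _ _ _ _ _ f (fun v : 'rV[R]_n => v 0 i));
    [exact: coord_continuous|exact: cf].
Qed.

Lemma continuous_addr (f g : T -> R) : continuous f -> continuous g ->
  continuous (fun t => f t + g t).
Proof. by move=> cf cg t; apply: cvgD; [exact: cf|exact: cg]. Qed.

Lemma continuous_mulr (f g : T -> R) : continuous f -> continuous g ->
  continuous (fun t => f t * g t).
Proof. by move=> cf cg t; apply: cvgM; [exact: cf|exact: cg]. Qed.

End ContinuousVector.

Lemma continuous_fst {T U V : topologicalType} (f : T -> U * V) : continuous f ->
  continuous (fun t => (f t).1).
Proof. by move=> cf t; apply: (cvg_comp _ _ (cf t)); exact: cvg_fst. Qed.

Lemma continuous_snd {T U V : topologicalType} (f : T -> U * V) : continuous f ->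
  continuous (fun t => (f t).2).
Proof. by move=> cf t; apply: (cvg_comp _ _ (cf t)); exact: cvg_snd. Qed.

Lemma closed_preimage {T U : topologicalType} (f : T -> U) (C : set U) :
  continuous f -> closed C -> closed [set t | C (f t)].
Proof. by move=> cf cC; apply: preimage_closed => // t _; exact: cf. Qed.

Lemma id_continuous {T : topologicalType} : continuous (fun t : T => t).
Proof. by move=> t; exact: cvg_id. Qed.

Ltac cont := lazymatch goal with
  | |- continuous (fun t => t) => exact: id_continuous
  | |- continuous (fun t => dot (@?f t) (@?g t)) => apply: (@continuous_dot _ _ _ f g); cont
  | |- continuous (fun t => enorm (@?f t)) => apply: (@continuous_enorm _ _ _ f); cont
  | |- continuous (fun t => @?f t *m ?M) => apply: (@continuous_mulmx _ _ _ M f); cont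
  | |- continuous (fun t => @?a t *: @?f t) => apply: (@continuous_scalev _ _ _ a f); cont
  | |- continuous fst => exact: (@continuous_fst _ _ _ (fun t => t) (@id_continuous _))
  | |- continuous snd => exact: (@continuous_snd _ _ _ (fun t => t) (@id_continuous _))
  | |- continuous (fun t => (@?f t).1) => apply: (@continuous_fst _ _ _ f); cont
  | |- continuous (fun t => (@?f t).2) => apply: (@continuous_snd _ _ _ f); cont
  | |- continuous (fun t => @?f t - @?g t) => apply: (@continuous_subv _ _ _ f g); cont
  | |- continuous (fun t => @?f t + @?g t) =>
      first [apply: (@continuous_addr _ _ f g)|apply: (@continuous_addv _ _ _ f g)]; cont
  | |- continuous (fun t => @?f t * @?g t) => apply: (@continuous_mulr _ _ f g); cont
  | |- continuous (fun t => ?c) => exact: cst_continuous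
  | _ => idtac
  end.

(** * Approximate second fundamental forms as projections of sigma-compact sets *)

Section Shape.
Context {R : realType} {n : nat}.
Implicit Types (K : set 'rV[R]_n) (x u v : 'rV[R]_n) (M : 'M[R]_n) (e d s : R).

Definition normals K x : set 'rV[R]_n :=
  [set u | enorm u = 1 /\ forall y, K y -> dot (y - x) u <= 0].

Definition regular K x u := K x /\ normals K x = [set u].

Definition hgt M e v : R := 2^-1 * dot (v *m M) v + e * dot v v.

(** Bounds the depth of the boundary under x + v without a graph function, so it makes sense at
    every point; the existential over s becomes a projection. *)
Definition below K x u v (h : R) := exists2 s, s <= h & K (x + v - s *: u).

(* If u is normal to K at x and the boundary near x is the graph of the depth f
   below the tangent hyperplane, this says that 1/2 <vM, v> - e |v|^2 < f(v)
   <= 1/2 <vM, v> + e |v|^2 for nonzero tangent vectors v shorter than d. *)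
Definition osc K x u M e d := forall v, dot v u = 0 -> enorm v < d ->
  below K x u v (hgt M e v) /\ (v != 0 -> ~ below K x u v (hgt M (- e) v)).

(* A frame-free encoding of the second fundamental form A: up to the error e,
   M is A on the tangent hyperplane and lam on the normal line. *)
Definition approx_shape K (lam : R) M e x := exists u d,
  [/\ regular K x u, enorm (u *m M - lam *: u) <= e, 0 < d & osc K x u M e d].

Section measurability.
Variables (K : set 'rV[R]_n) (lam : R).
Hypothesis cK : compact K.
Local Notation T2 := ('rV[R]_n * 'rV[R]_n)%type.
Local Notation T3 := (T2 * 'rV[R]_n)%type.
Local Notation T4 := (T3 * R)%type.

Let clK : closed K.
Proof. by apply: compact_closed => //; exact: norm_hausdorff. Qed.

(** The unit normal bundle of K. *)
Let C2 : set T2 := [set p | K p.1 /\ normals K p.1 p.2].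

Let C2_closed : closed C2.
Proof.
rewrite (_ : C2 = [set p | K p.1] `&` ([set p | enorm p.2 = 1] `&`
    \bigcap_(y in K) [set p | dot (y - p.1) p.2 <= 0])); last first.
  by apply/seteqP; split => p /= [Kp [p1 h]]; split.
apply: closedI; first by apply: (closed_preimage (f := fun p => p.1)) => //; cont.
apply: closedI; first by apply: closed_eq_continuous; cont.
by apply: closed_bigI => y _; apply: closed_le_continuous; cont.
Qed.

Let C2_compact : compact C2.
Proof.
apply: (subclosed_compact (B := K `*` [set u | enorm u <= 1]) C2_closed).
- by apply: compact_setX; [exact: cK|exact: enorm_ball_compact].
- by move=> [x u] [/= Kx [u1 _]]; split => //=; rewrite u1.
Qed.

Let C3 d : set T3 := [set p | [/\ C2 p.1, dot p.2 p.1.2 = 0 & enorm p.2 <= d]].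

Let C3_closed d : closed (C3 d).
Proof.
rewrite (_ : C3 d = [set p | C2 p.1] `&` ([set p | dot p.2 p.1.2 = 0] `&`
    [set p | enorm p.2 <= d])); last first.
  by apply/seteqP; split => p /=; [case|case=> ? []].
apply: closedI; first by apply: (closed_preimage (f := fun p => p.1)); [cont|exact: C2_closed].
apply: closedI; first by apply: closed_eq_continuous; cont.
by apply: closed_le_continuous; cont.
Qed.

Let C3_compact d : compact (C3 d).
Proof.
apply: (subclosed_compact (B := C2 `*` [set u | enorm u <= d]) (@C3_closed d)).
- by apply: compact_setX; [exact: C2_compact|exact: enorm_ball_compact].
- by move=> [x u] [].
Qed.

Let C4 M e d : set T4 :=
  [set p | [/\ C3 d p.1, p.2 <= hgt M e p.1.2 & K (p.1.1.1 + p.1.2 - p.2 *: p.1.1.2)]].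

Let C4_closed M e d : closed (C4 M e d).
Proof.
rewrite (_ : C4 M e d = [set p | C3 d p.1] `&` ([set p | p.2 <= hgt M e p.1.2] `&`
    [set p | K (p.1.1.1 + p.1.2 - p.2 *: p.1.1.2)])); last first.
  by apply/seteqP; split => p /=; [case|case=> ? []].
apply: closedI; first by apply: (closed_preimage (f := fun p => p.1)); [cont|exact: C3_closed].
apply: closedI; first by rewrite /hgt; apply: closed_le_continuous; cont.
apply: (closed_preimage (f := fun p : T4 => p.1.1.1 + p.1.2 - p.2 *: p.1.1.2)); last exact: clK.
by cont.
Qed.

(** The depth s is bounded: s u is the difference of x + v and a point of K, and K lies in a ball of
    radius B. *)
Let C4_compact M e d : compact (C4 M e d).
Proof.
have [B KB] : exists B, forall x, K x -> enorm x <= B.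
  have [->|/set0P K0] := eqVneq K set0; first by exists 0.
  have [|c Kc cB] := @compact_EVT_max _ _ (@enorm R n) _ K0 cK.
    by apply: continuous_subspaceT; apply: continuous_enorm; exact: id_continuous.
  by exists (enorm c) => x Kx; apply: cB; rewrite inE.
pose I := `[- (B + d + B), B + d + B].
apply: (subclosed_compact (B := C3 d `*` [set` I]) (@C4_closed M e d)).
- by apply: compact_setX; [exact: C3_compact|exact: segment_compact].
- move=> [[[x u] v] s] [/= [[/= Kx [u1 Nu]] vu vd] _ Ks]; split; first by split.
  rewrite /= in_itv/= -ler_norml.
  have -> : `|s| = enorm (s *: u) by rewrite enormZ u1 mulr1.
  rewrite [s *: u](_ : _ = x + v - (x + v - s *: u)); last by rewrite opprB addrC subrK.
  apply: le_trans (enormD _ _) _; rewrite enormN; apply: lerD (KB _ Ks).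
  by apply: le_trans (enormD _ _) _; exact: lerD (KB _ Kx) vd.
Qed.

(* (x, u, v) such that the graph over x + v is at depth at most hgt M e v *)
Let Z M e d : set T3 := C3 d `&` [set p | below K p.1.1 p.1.2 p.2 (hgt M e p.2)].

(** Compactness allows the depth to be projected away while keeping a closed set. *)
Let Z_closed M e d : closed (Z M e d).
Proof.
rewrite (_ : Z M e d = (fun p : T4 => p.1) @` C4 M e d).
  apply: compact_closed; first exact: norm_hausdorff.
  by apply: compact_image; [cont|exact: C4_compact].
apply/seteqP; split => [p [Cp [s sh Ks]]|_ [[p s] [/= Cp sh Ks] <-]].
  by exists (p, s).
by split => //; exists s.
Qed.

Let proj_measurable (A : set T3) d : Fsigma A ->
  measurable ((fun p : T3 => p.1.1) @` (C3 d `&` A) : set (surface_type K)).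
Proof.
move=> FA; apply: (@Fsigma_image_measurable R n K _ _ _ (C3 d)).
- by cont.
- exact: C3_compact.
- by move=> p [].
- by apply: FsigmaI => //; apply: closed_Fsigma; exact: C3_closed.
Qed.

Let E0 := (fun p : T2 => p.1) @` C2.

Let E0_measurable : measurable (E0 : set (surface_type K)).
Proof.
by apply: compact_surface_measurable; apply: compact_image; [cont|exact: C2_compact].
Qed.

(** Points where the upper bound of [osc] fails for some normal and some tangent vector. *)
Let E1 M e d := (fun p : T3 => p.1.1) @`
  (C3 d `&` ([set p | enorm p.2 < d] `&` ~` (Z M e d))).

Let E1_measurable M e d : measurable (E1 M e d : set (surface_type K)).
Proof.
apply: proj_measurable; apply: FsigmaI; apply: (@open_Fsigma R).
  by apply: open_lt_continuous; cont.
by apply: closed_openC; exact: Z_closed.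
Qed.

(** Points where the lower bound of [osc] fails at some nonzero tangent vector. *)
Let E2 M e d := (fun p : T3 => p.1.1) @`
  (C3 d `&` ([set p | enorm p.2 < d] `&` ([set p | 0 < enorm p.2] `&` Z M (- e) d))).

Let E2_measurable M e d : measurable (E2 M e d : set (surface_type K)).
Proof.
apply: proj_measurable; apply: FsigmaI.
  by apply: (@open_Fsigma R); apply: open_lt_continuous; cont.
apply: FsigmaI; last by apply: closed_Fsigma; exact: Z_closed.
by apply: (@open_Fsigma R); apply: open_lt_continuous; cont.
Qed.

(** Points where M is too far from [lam] on a normal. The radius 0 in [C3 0] forces the tangent
    vector to be 0, so the triple amounts to (x, u). *)
Let E3 M e := (fun p : T3 => p.1.1) @`
  (C3 0 `&` [set p | e < enorm (p.1.2 *m M - lam *: p.1.2)]).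

Let E3_measurable M e : measurable (E3 M e : set (surface_type K)).
Proof.
by apply: proj_measurable; apply: (@open_Fsigma R); apply: open_lt_continuous; cont.
Qed.

(** Points with two distinct unit normals. *)
Let E4 : set 'rV[R]_n := (fun p : T2 * T2 => p.1.1) @`
  ((C2 `*` C2) `&` ([set p | enorm (p.1.1 - p.2.1) = 0] `&` [set p | 0 < enorm (p.1.2 - p.2.2)])).

Let E4_measurable : measurable (E4 : set (surface_type K)).
Proof.
have C22 : compact (C2 `*` C2) by apply: compact_setX; exact: C2_compact.
apply: (@Fsigma_image_measurable R n K _ _ _ (C2 `*` C2)) => //.
- by cont.
- apply: FsigmaI.
    by apply: closed_Fsigma; apply: compact_closed C22; exact: norm_hausdorff.
  apply: FsigmaI; first by apply: closed_Fsigma; apply: closed_eq_continuous; cont.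
  by apply: (@open_Fsigma R); apply: open_lt_continuous; cont.
Qed.

Let regularE x : (exists u, regular K x u) <-> E0 x /\ ~ E4 x.
Proof.
split=> [[u [Kx Nx]]|[[[x' u] [/= Kx Nu] <-] nE]].
  have Nu : normals K x u by rewrite Nx.
  split; first by exists (x, u).
  move=> [[[x1 u1] [x2 u2]] [[/= [/= _ N1] [/= _ N2]]] [/= /enorm_eq0/subr0_eq x12 u12] x1x].
  subst x2 x1; move: N1 N2 u12; rewrite Nx /= => -> ->.
  by rewrite subrr enorm0 ltxx.
exists u; split => //; apply/seteqP; split => [w Nw|_ -> //] /=.
apply: contrapT => wu; apply: nE; exists ((x', u), (x', w)) => //; split; first by split.
split => /=; first by rewrite subrr enorm0.
by apply: enorm_gt0; rewrite subr_eq0; apply/eqP => uw; exact: wu.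
Qed.

(** Off [E4] the normal is unique, so failing for some normal is the same as failing for the normal.
    Since [osc] only gets weaker as d decreases, d may be taken of the form 1/(k+1). *)
Lemma approx_shape_measurable M e :
  measurable (approx_shape K lam M e : set (surface_type K)).
Proof.
rewrite (_ : approx_shape K lam M e = (E0 `\` E4 `\` E3 M e) `&`
   \bigcup_k (~` E1 M e k.+1%:R^-1 `&` ~` E2 M e k.+1%:R^-1)).
  apply: measurableI.
    by apply: measurableD; [apply: measurableD;
        [exact: E0_measurable|exact: E4_measurable]|exact: E3_measurable].
  apply: bigcupT_measurable => k; apply: measurableI; apply: measurableC.
      exact: E1_measurable.
    exact: E2_measurable.
apply/seteqP; split => x.
- move=> [u [d [xu uM d0 oscu]]].
  have [E0x E4x] : E0 x /\ ~ E4 x by apply/regularE; exists u.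
  have [Kx Nx] := xu.
  have Nuniq w : normals K x w -> w = u by rewrite Nx.
  split.
    split; first by split.
    move=> [[[x' w] v] [[/= [/= _ Nw] _ _] /= h] /= x'x]; subst x'.
    by move: h; rewrite (Nuniq _ Nw) ltNge uM.
  have [k kd] := natSinv_lt d0.
  exists k => //; split.
    move=> [[[x' w] v] [[/= [/= _ Nw] vw _] /= [vk nZ]] /= x'x]; subst x'.
    have wu := Nuniq _ Nw; subst w.
    by apply: nZ; split; [split => //=; exact: ltW|exact: (oscu v vw (lt_trans vk kd)).1].
  move=> [[[x' w] v] [[/= [/= _ Nw] vw _] /= [vk [v0 [_ Zp]]]] /= x'x]; subst x'.
  have wu := Nuniq _ Nw; subst w.
  apply: (oscu v vw (lt_trans vk kd)).2 => //.
  by apply/eqP => v00; move: v0; rewrite v00 enorm0 ltxx.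
- move=> [[[E0x E4x] E3x] [k _ [E1x E2x]]].
  have /regularE[u xu] := conj E0x E4x.
  have [Kx Nx] := xu; have Nu : normals K x u by rewrite Nx.
  exists u, k.+1%:R^-1; split => //.
  + rewrite leNgt; apply/negP => h; apply: E3x; exists ((x, u), 0) => //.
    by split => //=; split => //=; rewrite ?dot0l ?enorm0.
  + move=> v vu vk; split.
      apply: contrapT => nb; apply: E1x; exists ((x, u), v) => //; split.
        by split => //=; exact: ltW.
      by split => //= -[_].
    move=> v0 b; apply: E2x; exists ((x, u), v) => //.
    have Cv : C3 k.+1%:R^-1 ((x, u), v) by split => //=; exact: ltW.
    by split => //; split => //; split => //=; exact: enorm_gt0.
Qed.

(** Provides the sublevel sets of the support function at the regular points. *)
Lemma support_measurable c :
  measurable ([set x | exists2 u, regular K x u & dot x u <= c] : set (surface_type K)).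
Proof.
rewrite (_ : [set x | _] = (E0 `\` E4) `&`
    (fun p : T2 => p.1) @` (C2 `&` [set p | dot p.1 p.2 <= c])).
  apply: measurableI; first by apply: measurableD.
  apply: (@Fsigma_image_measurable R n K _ _ _ C2) => //; first by cont.
  apply: closed_Fsigma; apply: closedI; first exact: C2_closed.
  by apply: closed_le_continuous; cont.
apply/seteqP; split => x.
  move=> [u xu uc]; split; first by apply/regularE; exists u.
  by have [Kx Nx] := xu; exists (x, u) => //; split; [split => //=; rewrite Nx|].
move=> [/regularE[u xu] [[x' w] /= [[/= _ Nw] wc] x'x]]; subst x'.
by exists u => //; have [_ Nx] := xu; move: Nw wc; rewrite Nx => ->.
Qed.

End measurability.
End Shape.

(** * Approximate second fundamental forms *)

Section ShapeForm.
Context {R : realType} {n : nat}.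
Variables (K : set 'rV[R]_n) (lam : R).
Implicit Types (x u v w : 'rV[R]_n) (M : 'M[R]_n) (e d s : R).

Lemma dot_mulmxC M v w : M^T = M -> dot (v *m M) w = dot v (w *m M).
Proof. by move=> Ms; rewrite !dotE trmx_mul Ms mulmxA. Qed.

Lemma hgtZ M e s v : hgt M e (s *: v) = s ^+ 2 * hgt M e v.
Proof. by rewrite /hgt -scalemxAl !dot_lin; ring. Qed.

Lemma enorm_le_sum x : enorm x <= \sum_i `|x 0 i|.
Proof.
rewrite -(@ler_pXn2r _ 2)// ?nnegrE ?enorm_ge0 ?sumr_ge0// enorm_sqr.
rewrite [leRHS]expr2 mulr_suml; apply: ler_sum => i _.
rewrite -expr2 -real_normK ?num_real// expr2 ler_wpM2l//.
by rewrite (bigD1 i)//= lerDl sumr_ge0.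
Qed.

Lemma enorm_mulmx_le M v (eta : R) : (forall i j, `|M i j| <= eta) ->
  enorm (v *m M) <= n%:R ^+ 2 * eta * enorm v.
Proof.
move=> Me; apply: le_trans (enorm_le_sum _) _.
have -> : n%:R ^+ 2 * eta * enorm v = \sum_(j < n) \sum_(i < n) (enorm v * eta).
  by rewrite !sumr_const !card_ord -[X in _ = X]mulr_natr -[X in _ = X * _]mulr_natr; ring.
apply: ler_sum => j _; rewrite mxE; apply: le_trans (ler_norm_sum _ _ _) _.
by apply: ler_sum => i _; rewrite normrM ler_pM// coord_le_enorm.
Qed.

(** Moving the entries by eta moves both u M and the quadratic form of a unit vector by at most n^2
    eta. *)
Lemma approx_shape_perturb M M' e (eta : R) x : (forall i j, `|M i j - M' i j| <= eta) ->
  approx_shape K lam M e x -> approx_shape K lam M' (e + n%:R ^+ 2 * eta) x.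
Proof.
move=> MM' [u [d [xu uM d0 ocu]]].
have D v : enorm (v *m (M' - M)) <= n%:R ^+ 2 * eta * enorm v.
  by apply: enorm_mulmx_le => i j; rewrite !mxE distrC.
have q v : `|dot (v *m M') v - dot (v *m M) v| <= n%:R ^+ 2 * eta * dot v v.
  rewrite -dotBl -mulmxBr; apply: le_trans (dot_le_enorm _ _) _.
  by rewrite -enorm_sqr expr2 mulrA ler_wpM2r ?enorm_ge0.
have u1 : enorm u = 1 by have [_ Nx] := xu; have [] : normals K x u by rewrite Nx.
exists u, d; split => //.
  rewrite [X in enorm X](_ : _ = (u *m M - lam *: u) + u *m (M' - M)); last first.
    by rewrite mulmxBr; set a := u *m M; apply/rowP => i; rewrite !mxE; ring.
  apply: le_trans (enormD _ _) _; apply: lerD => //.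
  by have := D u; rewrite u1 mulr1.
have mono (c : R) v : hgt M c v <= hgt M' (c + n%:R ^+ 2 * eta) v.
  have := q v; rewrite /hgt ler_norml; have := dot_ge0 v.
  set a := dot v v; set p := dot _ _; set p' := dot (v *m M') v; set k := _ * eta.
  move=> a0 /andP[h1 h2].
  have : 0 <= k * a by move: h1 h2; lra.
  rewrite mulrDl; move: h1 h2; lra.
have mono' (c : R) v : hgt M' (- (c + n%:R ^+ 2 * eta)) v <= hgt M (- c) v.
  have := q v; rewrite /hgt ler_norml; have := dot_ge0 v.
  set a := dot v v; set p := dot _ _; set p' := dot (v *m M') v; set k := _ * eta.
  move=> a0 /andP[h1 h2].
  have : 0 <= k * a by move: h1 h2; lra.
  rewrite mulNr mulrDl; move: h1 h2; lra.
move=> v vu vd; have [[s sh Ks] nb] := ocu v vu vd; split.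
  by exists s => //; exact: le_trans sh (mono _ _).
move=> v0 [t th Kt]; apply: (nb v0); exists t => //; exact: le_trans th (mono' _ _).
Qed.

Lemma approx_shape_mono M e e' x : e <= e' ->
  approx_shape K lam M e x -> approx_shape K lam M e' x.
Proof.
move=> ee' [u [d [xu uM d0 ocu]]]; exists u, d; split => //; first exact: le_trans uM ee'.
move=> v vu vd; have [[s sh Ks] nb] := ocu v vu vd; split.
  by exists s => //; apply: le_trans sh _; rewrite /hgt lerD2l ler_wpM2r ?dot_ge0.
move=> v0 [t th Kt]; apply: (nb v0); exists t => //; apply: le_trans th _.
by rewrite /hgt lerD2l ler_wpM2r ?dot_ge0// lerN2.
Qed.

(** Both matrices trap the same boundary near x, so their quadratic forms are close on the tangent
    hyperplane; they are also close on the normal, and polarization passes to the entries. *)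
Lemma approx_shape_close M M' e e' x : M^T = M -> M'^T = M' ->
  approx_shape K lam M e x -> approx_shape K lam M' e' x ->
  forall i j, `|M i j - M' i j| <= 3 * (e + e').
Proof.
move=> Ms Ms' [u [d [xu uM d0 ocu]]] [u' [d' [xu' uM' d0' ocu']]].
have [_ Nx] := xu; have [_ Nx'] := xu'.
have u'u : u' = u by have : normals K x u' by [rewrite Nx']; rewrite Nx.
subst u'; have u1 : enorm u = 1 by have [] : normals K x u by rewrite Nx.
pose D := M - M'.
have Ds : D^T = D by rewrite /D linearB /= Ms Ms'.
have uD : enorm (u *m D) <= e + e'.
  rewrite [u *m D](_ : _ = (u *m M - lam *: u) - (u *m M' - lam *: u)); last first.
    by rewrite /D mulmxBr; set a := u *m M; apply/rowP => i; rewrite !mxE; ring.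
  by apply: le_trans (enormD _ _) _; rewrite enormN lerD.
(* [osc] only speaks of short vectors, but [hgt] is homogeneous of degree 2, so v may be rescaled to
   half the smaller radius. There, a point of K at depth at most [hgt M1 e1] exists and none at
   depth at most [hgt M2 (- e2)]. *)
have cmp (M1 M2 : 'M[R]_n) e1 e2 d1 d2 v : 0 < d1 -> 0 < d2 ->
    osc K x u M1 e1 d1 -> osc K x u M2 e2 d2 -> dot v u = 0 -> v != 0 ->
    hgt M2 (- e2) v <= hgt M1 e1 v.
  move=> d10 d20 oc1 oc2 vu v0; have nv := enorm_gt0 v0.
  pose t := Num.min d1 d2 / (2 * enorm v).
  have m0 : 0 < Num.min d1 d2 by rewrite lt_min d10.
  have t0 : 0 < t by rewrite divr_gt0// mulr_gt0.
  have tv : enorm (t *: v) < Num.min d1 d2.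
    rewrite enormZ gtr0_norm//; have -> : t * enorm v = Num.min d1 d2 / 2.
      by rewrite /t; field; rewrite gt_eqF.
    by rewrite ltr_pdivrMr// ltr_pMr// ltr1n.
  move: tv; rewrite lt_min => /andP[tv1 tv2].
  have tvu : dot (t *: v) u = 0 by rewrite dotZl vu mulr0.
  have [[s sh Ks] _] := oc1 _ tvu tv1; have [_ nb] := oc2 _ tvu tv2.
  have tv0 : t *: v != 0 by rewrite scaler_eq0 (gt_eqF t0).
  have : hgt M2 (- e2) (t *: v) < hgt M1 e1 (t *: v).
    rewrite ltNge; apply/negP => h; apply: (nb tv0); exists s => //; exact: le_trans sh h.
  by rewrite !hgtZ ltr_pM2l ?exprn_gt0// => /ltW.
have qv v : dot v u = 0 -> `|dot (v *m D) v| <= 2 * (e + e') * dot v v.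
  move=> vu; have [->|v0] := eqVneq v 0; first by rewrite !dot0r normr0 mulr0.
  have := cmp M M' e e' d d' v d0 d0' ocu ocu' vu v0.
  have := cmp M' M e' e d' d v d0' d0 ocu' ocu vu v0.
  rewrite /D mulmxBr dotBl /hgt ler_norml => h1 h2.
  by apply/andP; split; move: h1 h2; rewrite !mulNr !mulrDr !mulrDl; lra.
(* Split w = v + s u. The tangent part costs twice e + e', the normal part once, and the cross term
   is absorbed by 2|s||v| <= s^2 + |v|^2; hence the constant 3. *)
have qw w : `|dot (w *m D) w| <= 3 * (e + e') * dot w w.
  have uu : dot u u = 1 by rewrite -enorm_sqr u1 expr1n.
  have [s [v [vu wE]]] : exists s v, dot v u = 0 /\ w = v + s *: u.
    by exists (dot w u), (w - dot w u *: u); rewrite dotBl dotZl uu mulr1 subrr subrK.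
  have ww : dot w w = enorm v ^+ 2 + `|s| ^+ 2.
    rewrite enorm_sqr real_normK ?num_real// {1 2}wE !dot_lin uu vu (dotC u v) vu; ring.
  have -> : dot (w *m D) w = dot (v *m D) v + 2 * s * dot (u *m D) v + s ^+ 2 * dot (u *m D) u.
    rewrite {1 2}wE mulmxDl -scalemxAl !dot_lin (dot_mulmxC v u Ds) (dotC v); ring.
  have h1 : `|dot (u *m D) v| <= (e + e') * enorm v.
    by apply: le_trans (dot_le_enorm _ _) _; rewrite ler_wpM2r ?enorm_ge0.
  have h2 : `|dot (u *m D) u| <= (e + e').
    by apply: le_trans (dot_le_enorm _ _) _; rewrite u1 mulr1.
  have h3 := qv v vu.
  apply: le_trans (ler_normD _ _) _; apply: le_trans (lerD (ler_normD _ _) (lexx _)) _.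
  rewrite !normrM normr_nat -(expr2 `|s|) ww.
  move: h1 h2 h3; rewrite -enorm_sqr.
  set a := `|dot (u *m D) v|; set b := `|dot (u *m D) u|; set c := `|dot (v *m D) v|.
  set p := enorm v; set q := `|s|; set ep := e + e' => h1 h2 h3.
  have q0 : 0 <= q by exact: normr_ge0.
  have p0 : 0 <= p by exact: enorm_ge0.
  have ep0 : 0 <= ep by exact: le_trans (enorm_ge0 _) uD.
  have k1 : 2 * q * a <= 2 * q * (ep * p) by rewrite ler_wpM2l// mulr_ge0.
  have k2 : q ^+ 2 * b <= q ^+ 2 * ep by rewrite ler_wpM2l// sqr_ge0.
  have k3 : 0 <= ep * (p - q) ^+ 2 by rewrite mulr_ge0// sqr_ge0.
  have -> : 3 * ep * (p ^+ 2 + q ^+ 2) = 2 * ep * p ^+ 2 +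
      (2 * q * (ep * p) + ep * (p - q) ^+ 2) + q ^+ 2 * ep + ep * q ^+ 2.
    by ring.
  have k4 : 0 <= ep * q ^+ 2 by rewrite mulr_ge0// sqr_ge0.
  lra.
move=> i j; pose a : 'rV[R]_n := delta_mx 0 i; pose b : 'rV[R]_n := delta_mx 0 j.
have dd k l : dot (delta_mx 0 k : 'rV[R]_n) (delta_mx 0 l) = (k == l)%:R.
  rewrite /dot (bigD1 k)//= big1 => [|m mk]; rewrite !mxE ?eqxx ?mul1r ?addr0//=.
  by rewrite (negbTE mk) mul0r.
have Dij k l : dot ((delta_mx 0 k : 'rV[R]_n) *m D) (delta_mx 0 l) = D k l.
  rewrite -rowE /dot (bigD1 l)//= big1 => [|m mk]; rewrite !mxE ?eqxx ?mulr1 ?addr0//=.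
  by rewrite (negbTE mk) mulr0.
have Dsym : D j i = D i j by rewrite -[in LHS]Ds mxE.
(* Polarization: 4 D_ij is the difference of the form at a + b and a - b, whose squared norms add up
   to 4. *)
have := qw (a + b); have := qw (a - b).
rewrite mulmxBl mulmxDl !dot_lin !Dij !dd Dsym !eqxx (eq_sym j i).
have -> : M i j - M' i j = D i j by rewrite !mxE.
rewrite !ler_norml.
case: (i == j) => /= /andP[h1 h2] /andP[h3 h4]; apply/andP; split; move: h1 h2 h3 h4; lra.
Qed.

(** The radius may depend on e: this is the second-order expansion with an o(|v|^2) error. *)
Definition shape M x := M^T = M /\ forall e, 0 < e -> approx_shape K lam M e x.

Lemma shape_approx_close M M' e x : M'^T = M' -> shape M x ->
  approx_shape K lam M' e x -> forall i j, `|M i j - M' i j| <= 3 * e.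
Proof.
move=> Ms' [Ms sM] aM' i j; apply/ler_addgt0Pr => c c0.
have c3 : 0 < c / 3 by rewrite divr_gt0.
have := approx_shape_close Ms Ms' (sM _ c3) aM' i j; lra.
Qed.

Lemma shape_uniq M M' x : shape M x -> shape M' x -> M = M'.
Proof.
move=> sM [Ms' sM']; apply/matrixP => i j; apply/eqP.
rewrite -subr_eq0 -normr_le0; apply/ler_addgt0Pr => c c0.
have c3 : 0 < c / 3 by rewrite divr_gt0.
have := shape_approx_close Ms' sM (sM' _ c3) i j; lra.
Qed.

(** Approximants of error 1/(k+1) form a Cauchy sequence by [approx_shape_close], and its limit is
    the exact form by [approx_shape_perturb]. *)
Lemma shape_complete x :
  (forall k, exists M : 'M[R]_n, M^T = M /\ approx_shape K lam M k.+1%:R^-1 x) ->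
  exists M, shape M x.
Proof.
move=> /choice[F FP].
pose c k : R := 3 * k.+1%:R^-1.
have Fs k : (F k)^T = F k by have [] := FP k.
have close k l i j : `|F k i j - F l i j| <= c k + c l.
  have [_ ak] := FP k; have [_ al] := FP l.
  by have := approx_shape_close (Fs k) (Fs l) ak al i j; rewrite mulrDr.
(* The intervals of centre F_k and radius c_k meet pairwise, so the supremum of the left endpoints
   lies in all of them. *)
pose S i j := [set F k i j - c k | k in [set: nat]].
have Sub i j l : ubound (S i j) (F l i j + c l).
  move=> _ [k _ <-]; have := close k l i j; rewrite ler_norml => /andP[]; lra.
pose M : 'M[R]_n := \matrix_(i, j) sup (S i j).
have MF k i j : `|F k i j - M i j| <= c k.
  rewrite mxE ler_norml; apply/andP; split.
    have : sup (S i j) <= F k i j + c k by apply: ge_sup;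
        [exists (F 0%N i j - c 0%N), 0%N|exact: Sub].
    lra.
  have : F k i j - c k <= sup (S i j).
    by apply: ub_le_sup; [exists (F 0%N i j + c 0%N); exact: Sub|exists k].
  lra.
exists M; split.
  by apply/matrixP => i j; rewrite !mxE; congr sup; apply/seteqP; split => _ [k _ <-];
    exists k => //; rewrite -[in LHS]Fs mxE.
move=> e e0; pose N : R := 1 + n%:R ^+ 2 * 3.
have N0 : 0 < N by rewrite /N ltr_wpDr// mulr_ge0// sqr_ge0.
have [k kN] := natSinv_lt (divr_gt0 e0 N0).
have [_ ak] := FP k.
apply: approx_shape_mono (approx_shape_perturb (MF k) ak).
move: kN; rewrite ltr_pdivlMr// /N /c => /ltW.
by set a := k.+1%:R^-1; set b := n%:R ^+ 2; lra.
Qed.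

Lemma shape_rat M x (eta : R) : 0 < eta -> shape M x ->
  exists Q : 'M[rat]_n, [/\ (map_mx ratr Q : 'M[R]_n)^T = map_mx ratr Q,
    (forall i j, `|M i j - ratr (Q i j)| <= eta) &
    approx_shape K lam (map_mx ratr Q) ((n%:R ^+ 2 + 1) * eta) x].
Proof.
move=> eta0 [Ms sM].
have /choice[g gP] : forall y : R, exists q : rat, `|y - ratr q| <= eta.
  move=> y; have [|q] := @rat_in_itvoo R (y - eta) (y + eta); first by lra.
  by rewrite in_itv/= => /andP[h1 h2]; exists q; rewrite ler_norml; apply/andP; split; lra.
(* Rounding all entries by the same function [g] keeps the matrix symmetric. *)
exists (map_mx g M); split.
- by apply/matrixP => i j; rewrite !mxE -[in LHS]Ms mxE.
- by move=> i j; rewrite mxE.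
- rewrite mulrDl mul1r addrC; apply: approx_shape_perturb (sM _ eta0) => i j.
  by rewrite !mxE.
Qed.

End ShapeForm.

Lemma measurable_fun_lt d (T : measurableType d) (R : realType) (D : set T) (f : T -> R) :
  (forall b, measurable (D `&` [set x | f x < b])) -> measurable_fun D f.
Proof.
move=> Df mD; apply: (measurability _ (measurable_realfun.RGenInftyO.measurableE R)) => //.
move=> /= _ [_ [b ->] <-]; rewrite (_ : f @^-1` _ = [set x | f x < b])//.
Qed.

(** * Measurability of the exact second fundamental form *)

Section ShapeMeasurable.
Context {R : realType} {n : nat}.
Variables (K : set 'rV[R]_n) (lam : R).
Hypothesis cK : compact K.

Definition smooth : set 'rV[R]_n := [set x | exists M, shape K lam M x].

Definition shape_mx x : 'M[R]_n := xget 0 [set M | shape K lam M x].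

Lemma shape_mxP x : smooth x -> shape K lam (shape_mx x) x.
Proof. by move=> [M sM]; rewrite /shape_mx; case: xgetP => // /(_ M). Qed.

Lemma shape_mxE M x : shape K lam M x -> shape_mx x = M.
Proof. by move=> sM; apply: (shape_uniq _ sM); apply: shape_mxP; exists M. Qed.

(* A union over the countably many symmetric rational matrices. *)
Let rational_approx (P : 'M[R]_n -> Prop) e : set 'rV[R]_n :=
  \bigcup_(Q in [set Q : 'M[rat]_n |
      (map_mx ratr Q : 'M[R]_n)^T = map_mx ratr Q /\ P (map_mx ratr Q)])
    approx_shape K lam (map_mx ratr Q) e.

Let rational_approx_measurable P e :
  measurable (rational_approx P e : set (surface_type K)).
Proof.
rewrite /rational_approx bigcup_mkcond.
apply: countable_bigcupT_measurable => // Q; case: ifP => // _.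
exact: approx_shape_measurable.
Qed.

Let shape_rational_approx M x (e eta : R) : 0 < e -> 0 < eta -> shape K lam M x ->
  rational_approx (fun M' => forall i j, `|M i j - M' i j| <= eta) e x.
Proof.
move=> e0 eta0 sM.
pose N : R := n%:R ^+ 2 + 1.
have N0 : 0 < N by rewrite ltr_wpDl// sqr_ge0.
have m0 : 0 < Num.min eta (e / N) by rewrite lt_min eta0 divr_gt0.
have [Q [Qs QM aQ]] := shape_rat m0 sM.
exists Q.
  split => // i j; rewrite mxE; apply: le_trans (QM i j) _.
  by rewrite ge_min lexx.
apply: approx_shape_mono aQ; rewrite -/N mulrC -ler_pdivlMr//.
by rewrite ge_min lexx orbT.
Qed.

Lemma smooth_measurable : measurable (smooth : set (surface_type K)).
Proof.
rewrite (_ : smooth = \bigcap_k rational_approx (fun=> True) k.+1%:R^-1).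
  by apply: bigcapT_measurable => k; exact: rational_approx_measurable.
apply/seteqP; split => [x [M sM] k _|x xk].
  have k0 : 0 < k.+1%:R^-1 :> R by rewrite invr_gt0.
  by have [Q [Qs _] aQ] := shape_rational_approx k0 k0 sM; exists Q.
apply: shape_complete => k; have [Q [Qs _] aQ] := xk k I.
by exists (map_mx ratr Q).
Qed.

(** An approximant of error 1/(k+1) has entries within 3/(k+1) of the exact ones, so one whose entry
    is below b by more than 3/(k+1) certifies that the exact entry is below b. *)
Lemma shape_mx_measurable i j :
  measurable_fun (smooth : set (surface_type K)) (fun x => shape_mx x i j).
Proof.
apply: measurable_fun_lt => b.
rewrite (_ : _ `&` _ = smooth `&` \bigcup_k
    rational_approx (fun M => M i j + 3 * k.+1%:R^-1 < b) k.+1%:R^-1).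
  apply: measurableI; first exact: smooth_measurable.
  by apply: bigcupT_measurable => k; exact: rational_approx_measurable.
apply/seteqP; split => x [sx /=].
  have sM := shape_mxP sx; set M := shape_mx x in sM *.
  move=> Mb; split=> //; pose g := b - M i j.
  have g0 : 0 < g by rewrite subr_gt0.
  (* Of the gap g, the margin 3/(k+1) takes less than g/2 and the rounding at most g/4. *)
  have [|k kg] := @natSinv_lt R (g / 6); first by rewrite divr_gt0.
  have [||Q [Qs Qij] aQ] := @shape_rational_approx M x k.+1%:R^-1 (g / 4) _ _ sM.
  - by rewrite invr_gt0.
  - by rewrite divr_gt0.
  exists k => //; exists Q => //; split => //.
  have := Qij i j; rewrite ler_norml => /andP[h1 h2].
  by move: kg h1 h2; rewrite /g; set a := k.+1%:R^-1; set c := map_mx _ _ _ _; lra.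
move=> [k _ [Q [Qs Qij] aQ]]; split => //.
have := shape_approx_close Qs (shape_mxP sx) aQ i j.
rewrite ler_norml => /andP[h1 h2]; move: h1 h2 Qij.
by set a := k.+1%:R^-1; set c := map_mx _ _ _ _; lra.
Qed.

End ShapeMeasurable.

(** * Spectra of symmetric matrices and adapted frames *)

Section SymmetricSpectrum.

Lemma horner_char_poly {R : comNzRingType} m (A : 'M[R]_m) c :
  (char_poly A).[c] = \det (c%:M - A).
Proof.
rewrite /char_poly -[LHS]/(horner_eval c _) -det_map_mx; congr (\det _).
apply/matrixP => i j; rewrite !mxE /= /horner_eval.
by rewrite hornerD hornerN hornerMn hornerX hornerC.
Qed.

Lemma char_poly_conj {R : comUnitRingType} m (P A : 'M[R]_m) : P \in unitmx ->
  char_poly (invmx P *m A *m P) = char_poly A.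
Proof.
move=> Pu; rewrite /char_poly /char_poly_mx !map_mxM.
set P' := map_mx polyC P; set Q' := map_mx polyC (invmx P).
have QP : Q' *m P' = 1%:M by rewrite -map_mxM mulVmx// map_mx1.
have -> : 'X%:M - Q' *m map_mx polyC A *m P' = Q' *m ('X%:M - map_mx polyC A) *m P'.
  by rewrite mulmxBr mulmxBl; congr (_ - _); rewrite -mulmxA mul_scalar_mx -scalemxAr QP scalemx1.
by rewrite !det_mulmx mulrAC -det_mulmx QP det1 mul1r.
Qed.

(** The spectral theorem is applied to the complexified matrix, which is Hermitian; its eigenvalues
    are real, and the factorization descends because the map on polynomials is injective. *)
Lemma symmetric_char_poly_split {R : realType} m (A : 'M[R]_m) : A^T = A ->
  exists k : 'rV[R]_m, (forall i j : 'I_m, (i <= j)%N -> k 0 i <= k 0 j) /\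
    char_poly A = \prod_(i < m) ('X - (k 0 i)%:P).
Proof.
move=> As; pose C := R[i]%C; pose f : {rmorphism R -> C} := real_complex R.
pose B := map_mx f A.
have Bherm : B \is hermsymmx.
  apply: realsym_hermsym.
    by apply/is_hermitianmxP; rewrite expr0 scale1r map_mx_id// /B map_trmx As.
  by apply/mxOverP => i j; rewrite mxE; apply/complex_realP; exists (A i j).
have /orthomx_spectralP Bdiag := hermitian_normalmx Bherm.
have dreal i : exists y, spectral_diag B 0 i = f y.
  by apply/complex_realP; exact: (mxOverP (hermitian_spectral_diag_real Bherm)).
have {dreal}[d dE] := choice dreal.
have charA : char_poly A = \prod_(i < m) ('X - (d i)%:P).
  apply: (map_inj_poly (f := f)); [exact: complexI|by []|].
  rewrite map_char_poly -/B Bdiag char_poly_conj ?spectral_unit//.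
  rewrite char_poly_trig ?diag_mx_is_trig// rmorph_prod; apply: eq_bigr => i _.
  by rewrite rmorphB /= map_polyX map_polyC mxE eqxx dE.
pose s := sort <=%R [seq d i | i <- enum 'I_m].
have sizes : size s = m by rewrite size_sort size_map size_enum_ord.
exists (\row_i s`_i); split.
  move=> i j ij; rewrite !mxE; apply: (sorted_leq_nth (leT := <=%R)) => //.
  - exact: le_trans.
  - exact: sort_le_sorted.
  - by rewrite inE sizes.
  - by rewrite inE sizes.
transitivity (\prod_(z <- s) ('X - z%:P)).
  by rewrite (perm_big [seq d i | i <- enum 'I_m]) ?perm_sort//= big_map big_enum.
by rewrite (big_nth 0) sizes big_mkord; apply: eq_bigr => i _; rewrite mxE.
Qed.

End SymmetricSpectrum.

Section Frame.
Context {R : realType} {m : nat}.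
Implicit Types (u v : 'rV[R]_m.+1) (E : 'M[R]_(m, m.+1)).

Definition frame u E := [/\ enorm u = 1, E *m E^T = 1%:M & E *m u^T = 0].

Lemma frame_trmx u E : frame u E -> u *m E^T = 0.
Proof. by move=> [_ _ /(congr1 trmx)]; rewrite trmx_mul trmxK trmx0. Qed.

Lemma dot_mx u v : u *m v^T = (dot u v)%:M.
Proof. by apply/matrixP => i j; rewrite !ord1 !mxE eqxx mulr1n; apply: eq_bigr => k _;
    rewrite mxE. Qed.

Let ofr u E : 'M[R]_(1 + m, m.+1) := col_mx u E.

Lemma frame_ofr u E : frame u E -> ofr u E *m (ofr u E)^T = 1%:M.
Proof.
move=> uE; have [u1 EE Eu] := uE; rewrite /ofr (tr_col_mx u E) (mul_col_row u E).
rewrite EE Eu (frame_trmx uE) dot_mx -enorm_sqr u1 expr1n.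
exact: (esym (scalar_mx_block 1 m 1)).
Qed.

Lemma frame_complete u E : frame u E -> u^T *m u + E^T *m E = 1%:M.
Proof.
move=> /frame_ofr/mulmx1C; rewrite /ofr (tr_col_mx u E).
by rewrite (mul_row_col u^T E^T u E).
Qed.

Lemma frame_decomp u E v : frame u E -> v = v *m E^T *m E + dot v u *: u.
Proof.
move=> uE; rewrite -[LHS]mulmx1 -(frame_complete uE) mulmxDr addrC !mulmxA.
by rewrite dot_mx mul_scalar_mx.
Qed.

(** An orthogonal matrix with first row u has a frame as its remaining rows. *)
Lemma frame_exists u : enorm u = 1 -> exists E, frame u E.
Proof.
move=> u1; pose e0 : 'rV[R]_m.+1 := delta_mx 0 0.
have uu : dot u u = 1 by rewrite -enorm_sqr u1 expr1n.
have lsh0 : lshift m (0 : 'I_1) = 0 :> 'I_m.+1 by exact/val_inj.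
suff [H [HH Hu]] : exists H : 'M[R]_(1 + m, m.+1), H *m H^T = 1%:M /\ usubmx H = u.
  exists (dsubmx H); move: HH; rewrite -[H]vsubmxK Hu (tr_col_mx u) (mul_col_row u).
  rewrite (scalar_mx_block 1 m 1) => /eq_block_mx[_ _ h1 h2].
  by split => //; rewrite ?col_mxKd.
have [->|ue] := eqVneq u e0.
  exists 1%:M; rewrite trmx1 mulmx1; split => //.
  by apply/matrixP => i j; rewrite ord1 !mxE lsh0 eqxx /= eq_sym.
pose w := u - e0; pose c := 2 / dot w w.
have w0 : dot w w != 0.
  by apply: contra_neq ue => /dot_eq0/eqP; rewrite subr_eq0 => /eqP.
have ue0 v : dot v e0 = v 0 0.
  rewrite /dot (bigD1 0)//= big1 => [|i i0]; rewrite !mxE ?eqxx ?mulr1 ?addr0//=.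
  by rewrite (negbTE i0) mulr0.
have ww : dot w w = - 2 * (u 0 0 - 1).
  by rewrite /w !dot_lin uu (dotC e0 u) !ue0 mxE !eqxx /=; ring.
(* The Householder reflection exchanging e0 and u. *)
pose H : 'M[R]_m.+1 := 1%:M - c *: (w^T *m w).
have HT : H^T = H by rewrite /H linearB /= trmx1 linearZ /= trmx_mul trmxK.
exists H; split.
  rewrite HT /H mulmxBr mulmx1 mulmxBl mul1mx -scalemxAl -scalemxAr.
  rewrite mulmxA -(mulmxA w^T) dot_mx -(mulmxA w^T) mul_scalar_mx -scalemxAr !scalerA.
  have -> : c * c * dot w w = 2 * c by rewrite /c; field.
  by set W := w^T *m w; apply/matrixP => i j; rewrite !mxE; ring.
apply/matrixP => i j; rewrite ord1 !mxE lsh0 big_ord1 !mxE !eqxx /=.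
have h : c * (u 0 0 - 1) = -1.
  by apply: (mulIf w0); rewrite /c mulrAC mulfVK// ww; ring.
rewrite mulrA h (eq_sym j); ring.
Qed.

(** In the orthonormal basis formed by u and the rows of E, M is block diagonal with blocks lam and
    E M E^T. *)
Lemma frame_block_det u E (M : 'M[R]_m.+1) lam c : frame u E -> M^T = M -> u *m M = lam *: u ->
  \det (M - c%:M) = (lam - c) * \det (E *m M *m E^T - c%:M).
Proof.
move=> uE Ms uM; have [u1 EE Eu] := uE; pose O := ofr u E.
have OO := frame_ofr uE.
have -> : \det (M - c%:M) = \det (O *m (M - c%:M) *m O^T).
  by rewrite !det_mulmx mulrC mulrA -det_mulmx (mulmx1C OO) det1 mul1r.
have Mu : M *m u^T = lam *: u^T by rewrite -[in LHS]Ms -trmx_mul uM linearZ.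
have -> : O *m (M - c%:M) *m O^T = @block_mx R 1 m 1 m (lam - c)%:M 0 0 (E *m M *m E^T - c%:M).
  rewrite mulmxBr mulmxBl mul_mx_scalar -scalemxAl OO /O /ofr (tr_col_mx u E) (mul_col_mx u E)
      (mul_col_row (u *m M)).
  rewrite uM -!scalemxAl (frame_trmx uE) -(mulmxA E) Mu -scalemxAr Eu !scaler0.
  rewrite dot_mx -enorm_sqr u1 expr1n (scalar_mx_block 1 m 1) (scale_block_mx c)
      (opp_block_mx (c *: _)) (add_block_mx (lam *: _)).
  by rewrite !scaler0 !oppr0 !addr0 !scale_scalar_mx !mulr1 raddfB.
by rewrite (@det_ublock R 1 m) det_scalar1.
Qed.

End Frame.

(** * Supporting balls *)

Section Support.
Context {R : realType} {n : nat}.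
Variables (K : set 'rV[R]_n).
Implicit Types (x u v w : 'rV[R]_n).

Lemma near0_enorm {k} (P : set 'rV[R]_k) : (\forall t \near (0 : 'rV[R]_k), P t) ->
  exists2 d : R, 0 < d & forall t, enorm t < d -> P t.
Proof.
by move=> /nbhs_enormP[d d0 dP]; exists d => // t td; apply: dP; rewrite subr0.
Qed.

Lemma normals_support x u : interior K 0 -> normals K x u -> 0 < dot x u.
Proof.
move=> /near0_enorm[d d0 dK] [u1 Ku].
have uu : dot u u = 1 by rewrite -enorm_sqr u1 expr1n.
have : dot ((d / 2) *: u - x) u <= 0.
  by apply/Ku/dK; rewrite enormZ u1 mulr1 ger0_norm ?ltr_pdivrMr ?ltr_pMr ?ltr1n// divr_ge0// ltW.
by rewrite dotBl dotZl uu mulr1 subr_le0; apply: lt_le_trans; rewrite divr_gt0.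
Qed.

Lemma normals_boundary x u : normals K x u -> ~ interior K x.
Proof.
move=> [u1 Ku] /nbhs_enormP[d d0 dK].
have uu : dot u u = 1 by rewrite -enorm_sqr u1 expr1n.
have : dot (x + (d / 2) *: u - x) u <= 0.
  apply/Ku/dK; rewrite addrAC subrr add0r enormZ u1 mulr1 ger0_norm ?divr_ge0 ?ltW//.
  by rewrite ltr_pdivrMr// ltr_pMr// ltr1n.
by rewrite addrAC subrr add0r dotZl uu mulr1 leNgt divr_gt0.
Qed.

Lemma outer_normal_regular x u : regular K x u -> outer_normal K x = u.
Proof.
move=> [_ Nx]; rewrite /outer_normal -/(normals K x) Nx.
by case: xgetP => [|/(_ u)/(_ erefl)]//.
Qed.

(** Among the compact set of admissible centres take one farthest from x. If that distance were less
    than r, all the balls would contain a common neighbourhood of x, and x would be interior to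
    K. *)
Lemma touching_ball r x : compact K -> ball_convex r K -> K x -> ~ interior K x ->
  exists2 c, K `<=` eball c r & enorm (x - c) = r.
Proof.
move=> cK bK Kx nix.
pose C := [set c | K `<=` eball c r].
have cC : closed C.
  rewrite (_ : C = \bigcap_(y in K) [set c | enorm (y - c) <= r]).
    apply: closed_bigI => y _; apply: closed_le_continuous; cont.
  by apply/seteqP; split => c /= Kc y Ky; exact: Kc.
have bC : C `<=` [set c | enorm c <= r + enorm x].
  move=> c Kc /=; rewrite -[c](subrK x); apply: le_trans (enormD _ _) _.
  by rewrite lerD2r enormB; exact: Kc.
have C0 : C !=set0.
  (* An empty family of balls has the whole space as intersection, which has no boundary point. *)
  apply/set0P/eqP => C0; apply: nix.
  rewrite bK (_ : \bigcap_(c in _) _ = setT) ?interiorT//.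
  by apply/seteqP; split => // y _ c /= Kc; have : C c by []; rewrite C0.
have kC : compact C by apply: subclosed_compact cC _ bC; exact: enorm_ball_compact.
have [|c] := @compact_EVT_max _ R (fun c : 'rV[R]_n => enorm (x - c)) _ C0 kC.
  by apply: continuous_subspaceT; cont.
rewrite inE => Kc cmax; exists c => //; apply/eqP; rewrite eq_le; apply/andP; split.
  exact: Kc.
rewrite leNgt; apply/negP => cr; apply: nix.
apply/nbhs_enormP; exists (r - enorm (x - c)); first by rewrite subr_gt0.
move=> y yx; rewrite bK => c' /= Kc'.
rewrite /eball /=; apply: le_trans (enorm_triangle x _ _) _.
have : enorm (x - c') <= enorm (x - c) by apply: cmax; rewrite inE.
move: yx; lra.
Qed.

Lemma touching_normal r c x : 0 < r -> K `<=` eball c r -> enorm (x - c) = r ->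
  normals K x (r^-1 *: (x - c)).
Proof.
move=> r0 Kc xc; split.
  by rewrite enormZ xc ger0_norm ?invr_ge0 ?ltW// mulVf// gt_eqF.
move=> y Ky; rewrite dotZr pmulr_rle0 ?invr_gt0//.
have h : enorm (y - c) ^+ 2 <= r ^+ 2.
  by rewrite ler_pXn2r ?nnegrE ?enorm_ge0 ?(ltW r0)//; exact: Kc.
have h2 : enorm (x - c) ^+ 2 = r ^+ 2 by rewrite xc.
move: h h2; rewrite !enorm_sqr (_ : y - c = (y - x) + (x - c)); last by rewrite addrA subrK.
rewrite !(dotDl (y - x)) !(dotDr (y - x)) (dotC (x - c) (y - x)).
have := dot_ge0 (y - x); lra.
Qed.

(** The touching ball at x yields a normal, which is u by uniqueness; this locates the centre. *)
Lemma regular_ball r x u : compact K -> 0 < r -> ball_convex r K -> regular K x u ->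
  K `<=` eball (x - r *: u) r.
Proof.
move=> cK r0 bK [Kx Nx].
have Nu : normals K x u by rewrite Nx.
have [c Kc xc] := touching_ball cK bK Kx (normals_boundary Nu).
have := touching_normal r0 Kc xc; rewrite Nx => <-.
by rewrite scalerA divff ?gt_eqF// scale1r opprB addrC subrK.
Qed.

(** A point of the ball at depth s under x + t v satisfies t^2 |v|^2 + s^2 <= 2 r s; the
    second-order expansion of s turns this into a bound on the form. *)
Lemma shape_ge r lam M x u v : compact K -> 0 < r -> ball_convex r K ->
  regular K x u -> shape K lam M x -> dot v u = 0 ->
  r^-1 * dot v v <= dot (v *m M) v.
Proof.
move=> cK r0 bK xu [_ sM] vu.
have [->|v0] := eqVneq v 0; first by rewrite !dot0r mulr0.
have Kr := regular_ball cK r0 bK xu; have [_ Nx] := xu.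
have u1 : enorm u = 1 by have [] : normals K x u by rewrite Nx.
have uu : dot u u = 1 by rewrite -enorm_sqr u1 expr1n.
have vv : 0 < dot v v by rewrite -enorm_sqr exprn_gt0// enorm_gt0.
rewrite mulrC ler_pdivrMr//; apply/ler_addgt0Pr => e e0.
(* Chosen so that the error 2 r e' |v|^2 equals e. *)
pose e' := e / (2 * r * dot v v).
have e'0 : 0 < e' by rewrite divr_gt0// !mulr_gt0.
have [u' [d [[_ Nx'] _ d0 ocu]]] := sM _ e'0.
have u'u : u' = u by have : normals K x u' by [rewrite Nx']; rewrite Nx.
subst u'; have nv := enorm_gt0 v0.
pose t := d / (2 * enorm v).
have t0 : 0 < t by rewrite divr_gt0// mulr_gt0.
have tvd : enorm (t *: v) < d.
  rewrite enormZ gtr0_norm//; have -> : t * enorm v = d / 2 by rewrite /t; field; rewrite gt_eqF.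
  by rewrite ltr_pdivrMr// ltr_pMr// ltr1n.
have tvu : dot (t *: v) u = 0 by rewrite dotZl vu mulr0.
have [[s sh Ks] _] := ocu _ tvu tvd.
have : enorm (x + t *: v - s *: u - (x - r *: u)) ^+ 2 <= r ^+ 2.
  by rewrite ler_pXn2r ?nnegrE ?enorm_ge0 ?(ltW r0)//; exact: Kr.
rewrite (_ : x + t *: v - s *: u - (x - r *: u) = t *: v + (r - s) *: u); last first.
  by apply/rowP => i; rewrite !mxE; ring.
rewrite enorm_sqr !dot_lin (dotC u v) vu uu !mulr0 !addr0 !add0r mulr1.
move: sh; rewrite hgtZ /hgt => sh h.
have h1 : t ^+ 2 * dot v v <= 2 * r * s.
  by have := sqr_ge0 s; move: h; rewrite !expr2; lra.
have h2 : 2 * r * s <= t ^+ 2 * (dot (v *m M) v * r + e).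
  apply: le_trans (ler_wpM2l _ sh) _; first by rewrite mulr_ge0// ltW.
  rewrite le_eqVlt; apply/orP; left; apply/eqP; rewrite /e'; field.
  by rewrite !gt_eqF.
by have := le_trans h1 h2; rewrite ler_pM2l ?exprn_gt0.
Qed.

End Support.

(** * Curvature *)

Section Curvature.
Context {R : realType} {m : nat}.
Variables (K : set 'rV[R]_m.+1).
Hypotheses (cK : compact K) (K0 : interior K 0).
Implicit Types (x u v w : 'rV[R]_m.+1) (E : 'M[R]_(m, m.+1)).

Lemma frame_dot u E (t : 'rV[R]_m) : frame u E ->
  dot (t *m E) u = 0 /\ dot (t *m E) (t *m E) = dot t t.
Proof.
move=> [_ EE Eu]; split; first by rewrite dotE -mulmxA Eu mulmx0 mxE.
by rewrite dotE trmx_mul mulmxA -(mulmxA t) EE mulmx1 -dotE.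
Qed.

Lemma frame_coord u E v : frame u E -> dot v u = 0 -> v = v *m E^T *m E.
Proof. by move=> uE vu; rewrite {1}(frame_decomp v uE) vu scale0r addr0. Qed.

Definition ambient_form u E (A : 'M[R]_m) (lam : R) : 'M[R]_m.+1 :=
  E^T *m A *m E + lam *: (u^T *m u).

Lemma ambient_form_sym u E A lam : A^T = A -> (ambient_form u E A lam)^T = ambient_form u E A lam.
Proof. by move=> As; rewrite /ambient_form linearD linearZ /= !trmx_mul !trmxK As mulmxA. Qed.

Lemma ambient_form_normal u E A lam : frame u E -> u *m ambient_form u E A lam = lam *: u.
Proof.
move=> uE; have [u1 _ _] := uE.
rewrite /ambient_form mulmxDr -scalemxAr !mulmxA (frame_trmx uE) !mul0mx add0r.
by rewrite dot_mx -enorm_sqr u1 expr1n mul1mx.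
Qed.

Lemma ambient_form_restr u E A lam : frame u E -> E *m ambient_form u E A lam *m E^T = A.
Proof.
move=> uE; have [_ EE Eu] := uE.
rewrite /ambient_form mulmxDr mulmxDl !mulmxA EE mul1mx -mulmxA EE mulmx1.
by rewrite -scalemxAr -scalemxAl !mulmxA Eu !mul0mx scaler0 addr0.
Qed.

Lemma ambient_form_quad u E A lam (t : 'rV[R]_m) : frame u E ->
  dot (t *m E *m ambient_form u E A lam) (t *m E) = dot (t *m A) t.
Proof.
move=> uE; rewrite !dotE; set B := ambient_form _ _ _ _.
have -> : t *m E *m B *m (t *m E)^T = t *m (E *m B *m E^T) *m t^T by rewrite trmx_mul !mulmxA.
by rewrite ambient_form_restr.
Qed.

Lemma ambient_formK u E M lam : frame u E -> M^T = M -> u *m M = lam *: u ->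
  ambient_form u E (E *m M *m E^T) lam = M.
Proof.
move=> uE Ms uM; have Mu : M *m u^T = lam *: u^T by rewrite -[in LHS]Ms -trmx_mul uM linearZ.
have EE : E^T *m E = 1%:M - u^T *m u by rewrite -(frame_complete uE) addrC addKr.
rewrite /ambient_form !mulmxA EE -mulmxA EE mulmxBl mul1mx mulmxBr mulmx1.
rewrite mulmxBl -!mulmxA uM !mulmxA Mu -scalemxAr -scalemxAl -!mulmxA (mulmxA u).
rewrite uM -scalemxAl (mulmxA u) dot_mx; have [u1 _ _] := uE.
by rewrite -enorm_sqr u1 expr1n mul1mx -scalemxAr subrr subr0 subrK.
Qed.

(** Let a be the tangential part of another normal w. The boundary point over s a has depth O(s^2),
    so testing w on it gives s |a|^2 = O(s^2) and a = 0. Then w is a multiple of u, a positive one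
    because 0 is interior. *)
Lemma sff_graph_regular x u E (f : 'rV[R]_m -> R) (A : 'M[R]_m) (d : R) :
  frame u E -> normals K x u -> 0 < d ->
  (forall t, enorm t < d -> K (x + t *m E - f t *: u) /\
     `|f t - 2^-1 * dot (t *m A) t| <= dot t t) ->
  regular K x u.
Proof.
move=> uE Nu d0 fP; have [u1 EE Eu] := uE.
have [K1 f0] := fP 0 ltac:(by rewrite enorm0).
have f00 : f 0 = 0.
  by move: f0; rewrite mul0mx !dot0l mulr0 subr0 normr_le0 => /eqP.
have Kx : K x by move: K1; rewrite mul0mx f00 scale0r subr0 addr0.
split => //; apply/seteqP; split => [w Nw|_ ->//]; rewrite /=.
have [w1 Kw] := Nw.
pose a := w *m E^T; pose c := dot w u.
have bound t : enorm t < d -> dot t a <= f t * c.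
  move=> /fP[/Kw + _]; rewrite -(addrA x) addrAC subrr add0r dotBl dotZl subr_le0 (dotC u w).
  by have -> // : dot t a = dot (t *m E) w by rewrite /a !dotE trmx_mul trmxK mulmxA.
have a0 : a = 0.
  apply: dot_eq0; apply/eqP; rewrite eq_le dot_ge0 andbT; apply/ler_addgt0Pr => e e0.
  rewrite add0r.
  pose C := (`|2^-1 * dot (a *m A) a| + dot a a) * `|c|.
  have C0 : 0 <= C by rewrite mulr_ge0// addr_ge0// dot_ge0.
  (* The first bound keeps s a within the radius d, the second makes s C at most e. *)
  pose s := Num.min (d / (enorm a + 1)) (e / (C + 1)) / 2.
  have ea : 0 < enorm a + 1 by rewrite ltr_wpDl// enorm_ge0.
  have Ca : 0 < C + 1 by rewrite ltr_wpDl.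
  have m0 : 0 < Num.min (d / (enorm a + 1)) (e / (C + 1)) by rewrite lt_min !divr_gt0.
  have s0 : 0 < s by rewrite divr_gt0.
  have sm : s < Num.min (d / (enorm a + 1)) (e / (C + 1)) by rewrite ltr_pdivrMr// ltr_pMr//
      ltr1n.
  move: sm; rewrite lt_min => /andP[sd se].
  have sad : enorm (s *: a) < d.
    rewrite enormZ gtr0_norm//; move: sd; rewrite ltr_pdivlMr// mulrDr mulr1.
    by apply: le_lt_trans; rewrite lerDl ltW.
  have [_ fs] := fP _ sad; have := bound _ sad.
  rewrite dotZl; move: fs; rewrite -scalemxAl !dot_lin => fs.
  have fle : `|f (s *: a)| <= s ^+ 2 * (`|2^-1 * dot (a *m A) a| + dot a a).
    have -> : f (s *: a) = (f (s *: a) - 2^-1 * (s * (s * dot (a *m A) a))) + s ^+ 2 *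
        (2^-1 * dot (a *m A) a) by ring.
    apply: le_trans (ler_normD _ _) _; rewrite addrC mulrDr; apply: lerD.
      by rewrite normrM ger0_norm// sqr_ge0.
    by apply: le_trans fs _; rewrite expr2 mulrA.
  move=> h.
  have h2 : s * dot a a <= s * (s * C).
    apply: le_trans h _; apply: le_trans (ler_norm _) _; rewrite normrM.
    have -> : s * (s * C) = s ^+ 2 * (`|2^-1 * dot (a *m A) a| + dot a a) * `|c| by rewrite /C;
        ring.
    by rewrite ler_wpM2r.
  rewrite ler_pM2l// in h2; apply: le_trans h2 _.
  move: se; rewrite ltr_pdivlMr// mulrDr mulr1 => /ltW; apply: le_trans.
  by rewrite lerDl ltW.
have wE : w = c *: u by rewrite {1}(frame_decomp w uE) -/a a0 mul0mx add0r.
have xu := normals_support K0 Nu; have xw := normals_support K0 Nw.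
have c0 : 0 < c by move: xw; rewrite wE dotZr pmulr_lgt0.
have : `|c| = 1 by move: w1; rewrite wE enormZ u1 mulr1.
by rewrite gtr0_norm// => c1; rewrite wE c1 scale1r.
Qed.

Lemma sff_shape x A : second_fundamental_form K x A -> exists u E,
  [/\ frame u E, regular K x u, A^T = A & forall lam, shape K lam (ambient_form u E A lam) x].
Proof.
move=> [E [f [As EE Eu Kf fA]]]; set u := outer_normal K x in Eu Kf.
have Nu : normals K x u.
  rewrite /u /outer_normal -/(normals K x); case: xgetP => // noN.
  (* Without a normal the default u = 0 makes membership independent of the depth, so f 0 cannot be
     minimal: f 0 - 1 is admissible too. *)
  exfalso; have [d d0 Kd] := near0_enorm Kf.
  have [K1 _] := Kd 0 ltac:(by rewrite enorm0).
  have u0 : u = 0.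
    by rewrite /u /outer_normal -/(normals K x); case: xgetP => // w _ /noN.
  have [_ /(_ (f 0 - 1))] := Kd 0 ltac:(by rewrite enorm0).
  move: K1; rewrite u0 !scaler0 => K1 /(_ K1); lra.
have u1 : enorm u = 1 by have [] := Nu.
have uE : frame u E by [].
have xu : regular K x u.
  have [d1 d10 Kd1] := near0_enorm Kf; have [d2 d20 fd2] := near0_enorm (fA 1 ltr01).
  apply: (@sff_graph_regular x u E f A (Num.min d1 d2) uE Nu); first by rewrite lt_min d10.
  move=> t; rewrite lt_min => /andP[/Kd1[Kt _] /fd2]; rewrite mul1r enorm_sqr; by split.
exists u, E; split => // lam; split; first exact: ambient_form_sym.
(* Half the error leaves room for the strict lower bound that [osc] demands. *)
move=> e e0; have e20 : 0 < e / 2 by rewrite divr_gt0.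
have [d1 d10 Kd1] := near0_enorm Kf; have [d2 d20 fd2] := near0_enorm (fA _ e20).
exists u, (Num.min d1 d2); split => //.
- by rewrite (ambient_form_normal A lam uE) subrr enorm0 ltW.
- by rewrite lt_min d10.
move=> v vu vd; have vE := frame_coord uE vu; move: vd.
set t := v *m E^T in vE; have [_ tt] := frame_dot t uE.
have tv : enorm v = enorm t by rewrite vE /enorm tt.
rewrite tv lt_min => /andP[/Kd1[Kt ft] /fd2].
rewrite enorm_sqr /hgt [in dot (v *m _) v]vE (ambient_form_quad A lam t uE).
rewrite -[dot v v]enorm_sqr tv enorm_sqr ler_norml => /andP[h1 h2].
split.
  by exists (f t); [have := dot_ge0 t; move: h1 h2; nra|rewrite vE].
move=> v0 [s sh Ks].
have t0 : 0 < dot t t by rewrite -enorm_sqr -tv exprn_gt0// enorm_gt0.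
have : f t <= s by apply: ft; rewrite -vE.
have : 0 < e * dot t t by rewrite mulr_gt0.
move: h1 h2 sh; rewrite mulNr; set a := dot (t *m A) t; set b := dot t t.
lra.
Qed.

(** Converse of [sff_shape]: the graph function is recovered as the least depth at which the line in
    direction u meets K. *)
Lemma shape_sff x lam M : shape K lam M x -> exists u E A,
  [/\ frame u E, second_fundamental_form K x A & M = ambient_form u E A lam].
Proof.
move=> [Ms sM]; have [u [_ [xu _ _ _]]] := sM 1 ltr01.
have [Kx Nx] := xu; have [u1 Ku] : normals K x u by rewrite Nx.
have uu : dot u u = 1 by rewrite -enorm_sqr u1 expr1n.
have sMu e : 0 < e -> exists2 d, 0 < d & enorm (u *m M - lam *: u) <= e /\ osc K x u M e d.
  move=> /sM[u' [d [[_ Nx'] uM d0 ocu]]].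
  have u'u : u' = u by have : normals K x u' by [rewrite Nx']; rewrite Nx.
  by subst u'; exists d.
have uM : u *m M = lam *: u.
  apply/eqP; rewrite -subr_eq0; apply/eqP/enorm_eq0/eqP.
  rewrite eq_le enorm_ge0 andbT; apply/ler_addgt0Pr => e /sMu[d _ [+ _]].
  by rewrite add0r.
have [E uE] := frame_exists u1; have [_ EE Eu] := uE.
exists u, E, (E *m M *m E^T); split => //; last by rewrite ambient_formK.
pose sec v := [set s | K (x + v - s *: u)].
pose f (t : 'rV[R]_m) := xget 0 [set s | sec (t *m E) s /\ forall s', sec (t *m E) s' -> s <= s'].
have secE t : sec (t *m E) !=set0 -> sec (t *m E) (f t) /\ forall s', sec (t *m E) s' -> f t <=
    s'.
  move=> [s0 Ks0]; rewrite /f.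
  have sec0 s : sec (t *m E) s -> 0 <= s.
    move=> /Ku; have [tu _] := frame_dot t uE.
    by rewrite -(addrA x) addrAC subrr add0r dotBl tu dotZl uu mulr1 sub0r oppr_le0.
  (* Depths are nonnegative because u is a normal, and those above a known one are irrelevant to the
     minimum; this makes the set compact. *)
  pose S := sec (t *m E) `&` `[0, s0].
  have S0 : S !=set0 by exists s0; split => //=; rewrite in_itv/= lexx sec0.
  have kS : compact S.
    rewrite /S setIC; apply: compact_closedI; first exact: segment_compact.
    apply: (closed_preimage (f := fun s : R => x + t *m E - s *: u)).
      apply: continuous_subv; first exact: cst_continuous.
      by apply: continuous_scalev; [exact: id_continuous|exact: cst_continuous].
    by apply: compact_closed => //; exact: norm_hausdorff.
  have [|c] := @compact_EVT_min _ R (fun s : R => s) _ S0 kS.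
    by apply: continuous_subspaceT; exact: id_continuous.
  rewrite inE => -[Kc] /=; rewrite in_itv/= => /andP[_ cs0] cmin.
  case: xgetP => [//|/(_ c) []]; split => // s' Ks'.
  have [s's0|s0s'] := leP s' s0; last exact: le_trans cs0 (ltW s0s').
  by apply: cmin; rewrite inE; split => //=; rewrite in_itv/= s's0 sec0.
have ou : outer_normal K x = u by exact: outer_normal_regular.
have quad t : dot (t *m (E *m M *m E^T)) t = dot (t *m E *m M) (t *m E).
  by rewrite !dotE trmx_mul !mulmxA.
have fP e t d : 0 < e -> osc K x u M e d -> enorm t < d ->
    sec (t *m E) !=set0 /\ `|f t - 2^-1 * dot (t *m (E *m M *m E^T)) t| <= e * enorm t ^+ 2.
  move=> e0 ocu td; have [tu tt] := frame_dot t uE.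
  have tvd : enorm (t *m E) < d by rewrite /enorm tt.
  have [[s sh Ks] nb] := ocu _ tu tvd.
  have ne : sec (t *m E) !=set0 by exists s.
  split => //; have [Kf fmin] := secE t ne; rewrite enorm_sqr.
  (* The lower bound of [osc] excludes v = 0; there f vanishes, since x lies in K and depths are
     nonnegative. *)
  have [t0|t0] := eqVneq t 0.
    move: Kf fmin; rewrite t0 !mul0mx !dot0l !mulr0 subr0 => /Ku Kf fmin.
    rewrite normr_le0; apply/eqP/eqP; rewrite eq_le; apply/andP; split.
      by apply: fmin; rewrite /sec /= scale0r addr0 subr0.
    by move: Kf; rewrite addr0 addrAC subrr add0r dotNl dotZl uu mulr1 oppr_le0.
  have tE0 : t *m E != 0.
    apply: contra_neq t0 => tE; apply: dot_eq0; by rewrite -tt tE dot0l.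
  have fs := fmin _ Ks.
  have fgt : hgt M (- e) (t *m E) < f t.
    by rewrite ltNge; apply/negP => h; apply: (nb tE0); exists (f t).
  move: sh fgt; rewrite /hgt tt quad ler_norml mulNr => sh fgt; apply/andP; split;
      move: sh fgt fs; lra.
exists E, f; rewrite ou; split => //.
- by rewrite !trmx_mul trmxK Ms mulmxA.
- have [d d0 [_ ocu]] := sMu 1 ltr01; apply/nbhs_enormP; exists d => // t; rewrite subr0 => td.
  by have [ne _] := fP 1 t d ltr01 ocu td; have [] := secE t ne.
- move=> e e0; have [d d0 [_ ocu]] := sMu e e0; apply/nbhs_enormP; exists d => // t;
    rewrite subr0 => td.
  by have [] := fP e t d e0 ocu td.
Qed.

End Curvature.

Section PrincipalCurvatures.
Context {R : realType} {m : nat}.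
Variables (K : set 'rV[R]_m.+1) (r lam : R).
Hypotheses (cK : compact K) (K0 : interior K 0) (r0 : 0 < r) (bK : ball_convex r K).
Implicit Types (x u v : 'rV[R]_m.+1).

Lemma smooth_regular x : smooth K lam x -> regular K x (outer_normal K x).
Proof.
move=> [M [_ /(_ 1 ltr01)[u [_ [xu _ _ _]]]]].
by rewrite (outer_normal_regular xu).
Qed.

Lemma smooth_support x : smooth K lam x -> 0 < dot x (outer_normal K x).
Proof.
move=> /smooth_regular[_ Nx]; apply: (normals_support K0); by rewrite Nx.
Qed.

Lemma smooth_boundary x : smooth K lam x -> boundary K x.
Proof.
move=> /smooth_regular[Kx Nx]; split; first exact: subset_closure.
by apply: (@normals_boundary _ _ _ _ (outer_normal K x)); rewrite Nx.
Qed.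

Lemma principal_curvatures_not_smooth x : ~ smooth K lam x -> principal_curvatures K x = 0.
Proof.
move=> nx; rewrite /principal_curvatures; case: xgetP => // k _
    [_ [A /(sff_shape K0)[u [E [_ _ _ sA]]] _]].
by exfalso; apply: nx; exists (ambient_form u E A lam).
Qed.

(** Symmetric products of the curvatures come from a determinant of the measurable matrix
    [shape_mx]; the extra factor lam - c is contributed by the normal line. *)
Lemma smooth_principal_curvatures x : smooth K lam x ->
  (forall i, r^-1 <= kappa_ K x i) /\
  forall c, (lam - c) * \prod_(i < m) (kappa_ K x i - c) = \det (shape_mx K lam x - c%:M).
Proof.
move=> sx; rewrite /kappa_ /principal_curvatures.
case: xgetP => [k _ [_ [A /(sff_shape K0)[u [E [uE xu As sA]]] Ak]]|nok]; last first.
  exfalso; have [M /(shape_sff cK)[u [E [A [uE sA _]]]]] := sx.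
  have [_ [_ [_ _ As _]]] := sff_shape K0 sA.
  have [k [ksorted Ak]] := symmetric_char_poly_split As.
  by apply: (nok k); split => //; exists A.
rewrite (shape_mxE (sA lam)).
have AE := ambient_form_restr A lam uE.
split=> [i|c]; last first.
  rewrite (frame_block_det c uE (ambient_form_sym u E lam As) (ambient_form_normal A lam uE)) AE.
  congr (_ * _); have /(congr1 (fun p => p.[c])) := Ak.
  rewrite horner_char_poly horner_prod => h.
  have -> : A - c%:M = -1 *: (c%:M - A) by rewrite scaleN1r opprB.
  rewrite detZ h.
  rewrite (eq_bigr (fun i => - ('X - (k 0 i)%:P).[c])) ?prodrN ?card_ord// => i _.
  by rewrite hornerXsubC opprB.
(* An eigenvector of A, seen as a tangent vector, turns [shape_ge] into a bound on its
   eigenvalue. *)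
have /eigenvalueP[t tA t0] : eigenvalue A (k 0 i).
  rewrite eigenvalue_root_char Ak /root horner_prod (bigD1 i)//=.
  by rewrite hornerXsubC subrr mul0r.
have [tu tt] := frame_dot t uE.
have := shape_ge cK r0 bK xu (sA lam) tu.
rewrite tt ambient_form_quad// tA dotZl ler_pM2r//.
by rewrite -enorm_sqr exprn_gt0// enorm_gt0.
Qed.

End PrincipalCurvatures.

(** On the line tangent vectors are 0, so only uniqueness of the normal is at stake: unit normals
    are +1 or -1 and must have the sign of x. *)
Lemma boundary_smooth1 {R : realType} (K : set 'rV[R]_1) (r lam : R) x :
  compact K -> interior K 0 -> 0 < r -> ball_convex r K -> boundary K x -> smooth K lam x.
Proof.
move=> cK K0 r0 bK [clKx nix].
have Kx : K x by apply: (compact_closed _ cK) clKx; exact: norm_hausdorff.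
have [c Kc xc] := touching_ball cK bK Kx nix.
have Nu := touching_normal r0 Kc xc; set u := r^-1 *: _ in Nu.
have dot1 (a b : 'rV[R]_1) : dot a b = a 0 0 * b 0 0 by rewrite /dot big_ord1.
have xu : regular K x u.
  split => //; apply/seteqP; split => [w Nw|_ -> //] /=.
  have := normals_support K0 Nw; have := normals_support K0 Nu; rewrite !dot1.
  have : enorm w ^+ 2 = 1 by have [-> _] := Nw; rewrite expr1n.
  have : enorm u ^+ 2 = 1 by have [-> _] := Nu; rewrite expr1n.
  rewrite !enorm_sqr !dot1 => uu ww xu xw.
  apply/rowP => i; rewrite ord1.
  have uw : 0 < u 0 0 * w 0 0.
    have xx : 0 < x 0 0 * x 0 0.
      by rewrite lt_neqAle -expr2 sqr_ge0 andbT eq_sym sqrf_eq0; apply/eqP => x0; move: xu;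
          rewrite x0 mul0r ltxx.
    have := mulr_gt0 xu xw; rewrite mulrACA pmulr_rgt0//.
  have : (u 0 0 - w 0 0) * (u 0 0 + w 0 0) = 0.
    by rewrite -subr_sqr !expr2 uu ww subrr.
  move=> /eqP; rewrite mulf_eq0 => /orP[/eqP/subr0_eq ->//|/eqP h].
  have wu : w 0 0 = - u 0 0 by move: h; lra.
  by move: uw; rewrite wu mulrN uu oppr_gt0 ltr10.
have uu : u 0 0 != 0.
  by apply/eqP => u0; have := normals_support K0 Nu; rewrite dot1 u0 mulr0 ltxx.
exists lam%:M; split; first by rewrite tr_scalar_mx.
move=> e e0; exists u, 1; split => //; first by rewrite mul_mx_scalar subrr enorm0 ltW.
move=> v vu _.
have v0 : v = 0.
  apply/rowP => i; rewrite ord1 mxE; move: vu => /eqP;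
      rewrite dot1 mulf_eq0 (negbTE uu) orbF => /eqP//.
rewrite v0 eqxx; split => //; exists 0; last by rewrite addr0 scale0r subr0.
by rewrite /hgt mul0mx !dot0l !mulr0 addr0.
Qed.

(** * Densities and exponential moments *)

Section Density.
Local Open Scope ereal_scope.
Context d (T : measurableType d) (R : realType) (mu : {measure set T -> \bar R}).

(* Stated for set functions: [with_density mu w] carries no measure structure. *)
Lemma integral_subset0 (nu : set T -> \bar R) (B G : set T) (f g : T -> \bar R) : G `<=` B ->
  (forall x, B x -> ~ G x -> f x = 0) -> (forall x, G x -> f x = g x) ->
  \int[nu]_(x in B) f x = \int[nu]_(x in G) g x.
Proof.
move=> GB f0 fg; rewrite /integral; suff -> : f \_ B = g \_ G by [].
apply/funext => x; rewrite !patchE; have [Gx|nGx] := pselect (G x).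
  by rewrite !mem_set ?fg//; exact: GB.
rewrite (memNset nGx); have [Bx|nBx] := pselect (B x); last by rewrite memNset.
by rewrite mem_set// f0.
Qed.

Variable w : T -> R.
Hypotheses (mw : measurable_fun setT w) (w0 : forall x, (0 <= w x)%R).

Let mwE (D : set T) : measurable_fun D (EFin \o w).
Proof. by apply: measurable_funTS; exact/measurable_EFinP. Qed.

Let nu := with_density mu w.

Let nu0 : nu set0 = 0. Proof. exact: integral_set0. Qed.

Let nu_ge0 A : 0 <= nu A.
Proof. by apply: integral_ge0 => x _; rewrite lee_fin. Qed.

Let nu_sigma_additive : semi_sigma_additive nu.
Proof.
move=> F mF tF mUF; rewrite /nu /with_density ge0_integral_bigcup//.
- by apply: is_cvg_nneseries => k _ _; exact: nu_ge0.
- by move=> x _; rewrite lee_fin.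
Qed.

(** The same set function packed as a measure, to which the integration lemmas apply. *)
Let nuM : {measure set T -> \bar R} :=
  HB.pack nu (isMeasure.Build _ _ _ nu nu0 nu_ge0 nu_sigma_additive).

Import HBNNSimple.

(** Clear for indicators, hence for simple functions by linearity, and in general by monotone
    convergence on both sides. *)
Lemma ge0_integral_density (E : set T) (f : T -> \bar R) : measurable E ->
  measurable_fun E f -> (forall x, E x -> 0 <= f x) ->
  \int[with_density mu w]_(x in E) f x = \int[mu]_(x in E) (f x * (w x)%:E).
Proof.
move=> mE mf f0; pose h := nnsfun_approx mE mf.
have hf x : E x -> (EFin \o h k) x @[k --> \oo] --> f x.
  by move=> Ex; apply: cvg_nnsfun_approx.
have mh k : measurable_fun E (EFin \o h k).
  by apply/measurable_EFinP; apply: (measurable_funS measurableT) => //; exact/measurable_funP.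
have hnd x : nondecreasing_seq (fun k => (h k x)%:E).
  by move=> a b ab; rewrite lee_fin; exact/lefP/nd_nnsfun_approx.
have lhs : \int[nuM]_(x in E) f x = limn (fun k => \int[nuM]_(x in E) (EFin \o h k) x).
  rewrite -monotone_convergence//; last by move=> x _; exact: hnd.
    by apply: eq_integral => x /set_mem Ex; apply/esym/cvg_lim => //; exact: hf.
  by move=> k x _; rewrite lee_fin.
have rhs : \int[mu]_(x in E) (f x * (w x)%:E) =
    limn (fun k => \int[mu]_(x in E) ((EFin \o h k) x * (w x)%:E)).
  rewrite -monotone_convergence//.
  - apply: eq_integral => x /set_mem Ex; apply/esym/cvg_lim => //.
    by apply: cvgeZr => //; exact: hf.
  - by move=> k; apply: emeasurable_funM => //; exact: mwE.
  - by move=> k x _; rewrite mule_ge0 ?lee_fin.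
  - by move=> x _ a b ab; rewrite lee_wpmul2r ?lee_fin//; have := hnd x a b ab; rewrite lee_fin.
rewrite (_ : \int[_]_(x in E) f x = \int[nuM]_(x in E) f x)// lhs rhs.
congr (limn _); apply/funext => k.
have mi y : measurable_fun E (fun x => \1_(h k @^-1` [set y]) x : R).
  exact: measurable_indic.
transitivity (\int[nuM]_(x in E) (\sum_(y \in range (h k)) (y * \1_(h k @^-1` [set y]) x)%:E)).
  by apply: eq_integral => x _; rewrite /= fimfunE -fsumEFin.
rewrite ge0_integral_fsum//; last 2 first.
- by move=> y; apply/measurable_EFinP; exact: measurable_funM.
- by move=> y x _; exact: nnfun_muleindic_ge0.
transitivity (\int[mu]_(x in E) (\sum_(y \in range (h k))
    ((y * \1_(h k @^-1` [set y]) x)%:E * (w x)%:E))).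
  rewrite ge0_integral_fsum//; last 2 first.
  - move=> y; apply: emeasurable_funM; last exact: mwE.
    by apply/measurable_EFinP; exact: measurable_funM.
  - by move=> y x _; apply: mule_ge0; [exact: nnfun_muleindic_ge0|rewrite lee_fin].
  apply: eq_fsbigr => y; rewrite inE => -[z _ hz].
  have y0 : (0 <= y)%R by rewrite -hz.
  have mhy : measurable (h k @^-1` [set y]) by exact: measurable_funPTI.
  under eq_integral do rewrite EFinM.
  rewrite ge0_integralZl//; last exact/measurable_EFinP.
  rewrite integral_indic//=.
  under [RHS]eq_integral do rewrite EFinM -muleA.
  rewrite ge0_integralZl//; last 2 first.
  - by apply: emeasurable_funM; [exact/measurable_EFinP|exact: mwE].
  - by move=> x _; rewrite mule_ge0 ?lee_fin.
  congr (_ * _); rewrite /nu /with_density setIC integral_mkcondr.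
  by apply: eq_integral => x _; rewrite epatch_indic muleC.
apply: eq_integral => x _; rewrite -ge0_mule_fsuml => [|y]; last exact: nnfun_muleindic_ge0.
by rewrite fsumEFin// -fimfunE.
Qed.

(** Multiplying by w >= 0 commutes with taking positive and negative parts, so infinite integrals
    are covered. *)
Lemma integral_density (E : set T) (f : T -> R) : measurable E ->
  measurable_fun E f ->
  \int[with_density mu w]_(x in E) (f x)%:E = \int[mu]_(x in E) (f x * w x)%:E.
Proof.
move=> mE mf; rewrite -[LHS]/(\int[nuM]_(x in E) (f x)%:E) [LHS]integralE [RHS]integralE.
have mfE : measurable_fun E (EFin \o f) by exact/measurable_EFinP.
congr (_ - _).
  apply: (etrans (ge0_integral_density mE (measurable_funepos mfE) _)) => //.
  by apply: eq_integral => x _; rewrite !funeposE -!EFin_max -EFinM maxr_pMl// mul0r.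
apply: (etrans (ge0_integral_density mE (measurable_funeneg mfE) _)) => //.
by apply: eq_integral => x _; rewrite !funenegE -!EFinN -!EFin_max -EFinM maxr_pMl// mul0r mulNr.
Qed.

End Density.

(** * Monotone approximation of the logarithm and limits of exponential moments *)

Section ExpQuotient.
Context {R : realType}.
Implicit Types s t y : R.

Definition exp_quot s y : R := (1 - expR (- (s * y))) / s.

(* Both 1 and exp(-ty) lie above the tangent of exp at -sy. *)
Lemma exp_quot_noninc s t y : 0 < s -> s <= t -> exp_quot t y <= exp_quot s y.
Proof.
move=> s0 st; have t0 := lt_le_trans s0 st.
rewrite /exp_quot ler_pdivrMr// mulrAC ler_pdivlMr//.
set a := expR (- (s * y)); set b := expR (- (t * y)).
have a0 : 0 < a by exact: expR_gt0.
have h1 : a * (1 + s * y) <= 1.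
  by apply: le_trans (ler_wpM2l (ltW a0) (expR_ge1Dx _)) _; rewrite /a -expRD addNr expR0.
have h2 : a * (1 + (s - t) * y) <= b.
  apply: le_trans (ler_wpM2l (ltW a0) (expR_ge1Dx _)) _; rewrite /a -expRD /b.
  by rewrite le_eqVlt; apply/orP; left; apply/eqP; congr expR; ring.
have k1 : (t - s) * (a * (1 + s * y)) <= (t - s) * 1 by rewrite ler_wpM2l// subr_ge0.
have k2 : s * (a * (1 + (s - t) * y)) <= s * b by rewrite ler_wpM2l// ltW.
have k3 : (t - s) * (a * (1 + s * y)) + s * (a * (1 + (s - t) * y)) = t * a by ring.
by move: k1 k2 k3; lra.
Qed.

Lemma exp_quot_le s y : 0 < s -> exp_quot s y <= y.
Proof.
move=> s0; rewrite /exp_quot ler_pdivrMr// (mulrC y).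
by have := expR_ge1Dx (- (s * y)); lra.
Qed.

(** From exp(s y) >= 1 + s y; with [exp_quot_le] it squeezes the quotient as s tends to 0. *)
Lemma exp_quot_ge s y : 0 < s -> 0 < 1 + s * y -> y / (1 + s * y) <= exp_quot s y.
Proof.
move=> s0 sy; rewrite /exp_quot ler_pdivlMr//.
have -> : y / (1 + s * y) * s = 1 - (1 + s * y)^-1 by field; rewrite gt_eqF.
by rewrite lerD2l lerN2 expRN lef_pV2 ?posrE ?expR_gt0// expR_ge1Dx.
Qed.

Lemma exp_quot_cvg y : exp_quot k.+1%:R^-1 y @[k --> \oo] --> y.
Proof.
have cvg0 : (k.+1%:R^-1 : R) @[k --> \oo] --> 0 by exact: cvg_harmonic.
have cvg1 : 1 + k.+1%:R^-1 * y @[k --> \oo] --> (1 : R).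
  rewrite -[X in _ --> X]addr0 -(mul0r y); apply: cvgD; first exact: cvg_cst.
  by apply: cvgM => //; exact: cvg_cst.
apply: (@squeeze_cvgr _ _ _ _ (fun k => y / (1 + k.+1%:R^-1 * y)) (fun=> y)).
- near=> k; apply/andP; split; last by apply: exp_quot_le.
  apply: exp_quot_ge => //; near: k.
  move/cvgrPdist_lt: cvg1 => /(_ 1 ltr01); apply: filterS => k.
  by rewrite ltr_norml => /andP[_]; set z := _ * y; lra.
- rewrite -[X in _ --> X]divr1; apply: cvgM; first exact: cvg_cst.
  by apply: cvgV => //; exact: oner_neq0.
- exact: cvg_cst.
Unshelve. all: by end_near. Qed.

End ExpQuotient.

Section SemiIntegrable.
Local Open Scope ereal_scope.
Context d (T : measurableType d) (R : realType) (mu : {measure set T -> \bar R}).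

(** If f has infinite integral, the negative part of f + g is at most |g|, while f is at most the
    positive part plus |g|; so both sides are +oo. *)
Lemma integralD_ge0_integrable (D : set T) (f g : T -> \bar R) : measurable D ->
  measurable_fun D f -> (forall x, D x -> 0 <= f x) -> mu.-integrable D g ->
  \int[mu]_(x in D) (f x + g x) = \int[mu]_(x in D) f x + \int[mu]_(x in D) g x.
Proof.
move=> mD mf f0 ig; have mg := measurable_int _ ig.
have [foo|] := eqVneq (\int[mu]_(x in D) f x) +oo; last first.
  rewrite -ltey => fy; rewrite integralD//; apply/integrableP; split => //.
  by under eq_integral => x /set_mem Dx do rewrite gee0_abs ?f0//.
have mfg : measurable_fun D (f \+ g) by exact: emeasurable_funD.
have gy : \int[mu]_(x in D) `|g x| < +oo by have /integrableP[] := ig.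
have gfin : \int[mu]_(x in D) g x \is a fin_num by exact: integrable_fin_num.
rewrite foo addye; last by move: gfin; rewrite fin_numE => /andP[].
rewrite integralE -/(f \+ g).
have neg : \int[mu]_(x in D) (f \+ g)^\- x < +oo.
  apply: le_lt_trans gy; apply: ge0_le_integral => //.
  - by apply: measurable_funeneg.
  - exact: measurableT_comp.
  - move=> x Dx; rewrite funenegE ge_max abse_ge0 andbT leeNl.
    apply: (@le_trans _ _ (g x)); last by rewrite -[leLHS]add0e leeD ?f0.
    by rewrite leeNl -abseN lee_abs.
have pos : \int[mu]_(x in D) (f \+ g)^\+ x = +oo.
  apply/eqP; rewrite -leye_eq -foo.
  have : \int[mu]_(x in D) f x <= \int[mu]_(x in D) ((f \+ g)^\+ x + `|g x|).
    apply: ge0_le_integral => //.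
    - apply: emeasurable_funD; first exact: measurable_funepos.
      exact: measurableT_comp.
    - move=> x Dx; rewrite funeposE.
      have : 0 <= maxe (f x + g x) 0 by rewrite le_max lexx orbT.
      have := f0 x Dx; case: (f x) (g x) => [a| |] [b| |] a0 M0; rewrite ?leey//;
        try by rewrite addey ?leey// gt_eqF// (lt_le_trans _ M0).
      move=> {M0}.
      rewrite -EFin_max -EFinD lee_fin; rewrite lee_fin in a0.
      apply: (@le_trans _ _ (a + b + `|b|)%R); last by rewrite lerD2r le_max lexx.
      by have := ler_norm (- b)%R; rewrite normrN; lra.
  rewrite ge0_integralD//; last 2 first.
  - exact: measurable_funepos.
  - exact: measurableT_comp.
  rewrite foo leye_eq => /eqP; move: gy.
  by case: (\int[mu]_(x in D) `|g x|) (\int[mu]_(x in D) (f \+ g)^\+ x) => [a| |] [b| |].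
rewrite pos; case: (\int[mu]_(x in D) (f \+ g)^\- x) neg => //.
Qed.

End SemiIntegrable.

Section ExponentialMoments.
Local Open Scope ereal_scope.
Context d (T : measurableType d) (R : realType) (mu : {measure set T -> \bar R}).
Variables (G : set T) (psi ell : T -> R) (t0 c c0 : R).
Hypotheses (mG : measurable G) (mpsi : measurable_fun G psi) (mell : measurable_fun G ell).
Hypotheses (psi0 : forall x, G x -> (0 <= psi x)%R) (t01 : (1 <= t0)%R) (cpos : (0 < c)%R).

Definition exp_moment (s : R) : \bar R :=
  \int[mu]_(x in G) (expR (- (s * ell x)) * psi x)%:E.

Hypotheses (intc : \int[mu]_(x in G) (psi x)%:E = c%:E) (intc0 : exp_moment t0 = c0%:E).

Let mexp s : measurable_fun G (fun x => expR (- (s * ell x))).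
Proof.
apply: measurableT_comp => //; apply: measurableT_comp => //.
by apply: measurable_funM => //.
Qed.

Let mexppsi s : measurable_fun G (fun x => (expR (- (s * ell x)) * psi x)%R).
Proof. exact: measurable_funM. Qed.

Let ipsi : mu.-integrable G (EFin \o psi).
Proof.
apply/integrableP; split; first exact/measurable_EFinP.
by under eq_integral => x /set_mem Gx do rewrite /= ger0_norm ?psi0//; rewrite intc ltry.
Qed.

Let iexp0 : mu.-integrable G (fun x => (expR (- (t0 * ell x)) * psi x)%:E).
Proof.
apply/integrableP; split; first exact/measurable_EFinP.
under eq_integral => x /set_mem Gx do rewrite /= ger0_norm ?mulr_ge0 ?expR_ge0 ?psi0//.
by rewrite -/(exp_moment t0) intc0 ltry.
Qed.

Let t0pos : (0 < t0)%R. Proof. exact: lt_le_trans t01. Qed.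

(** Convexity of exp(-s ell) in s bounds it on [0, t0] by the sum of its values at the two ends. *)
Let iexp s : (0 < s)%R -> (s <= t0)%R ->
  mu.-integrable G (fun x => (expR (- (s * ell x)) * psi x)%:E).
Proof.
move=> s0 st; apply: (le_integrable mG _ _ (integrableD mG ipsi iexp0)).
  exact/measurable_EFinP.
move=> x Gx; rewrite -[leRHS]/(`|psi x + expR (- (t0 * ell x)) * psi x|)%:E lee_fin !ger0_norm
    ?addr_ge0 ?mulr_ge0 ?expR_ge0 ?psi0//.
rewrite -[X in (_ <= X + _)%R]mul1r -mulrDl ler_wpM2r ?psi0//.
have := exp_quot_noninc (ell x) s0 st.
rewrite /exp_quot ler_pdivrMr// mulrAC ler_pdivlMr//.
have e1 := expR_gt0 (- (s * ell x))%R; have e2 := expR_gt0 (- (t0 * ell x))%R.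
set a := expR (- (s * _))%R; set b := expR (- (t0 * _))%R => h.
rewrite -(ler_pM2l t0pos); move: h.
have : (s * b <= t0 * b)%R by rewrite ler_wpM2r// ltW.
lra.
Qed.

Let quot s x := (psi x * exp_quot s (ell x))%R.

Let quotE s x : (0 < s)%R -> quot s x = (s^-1 * psi x - s^-1 * (expR (- (s * ell x)) * psi x))%R.
Proof. by move=> s0; rewrite /quot /exp_quot; field; rewrite gt_eqF. Qed.

Let mquot s : measurable_fun G (quot s).
Proof.
apply: measurable_funM => //; apply: measurable_funM => //.
by apply: measurable_funB.
Qed.

Let iquot s : (0 < s)%R -> (s <= t0)%R -> mu.-integrable G (EFin \o quot s).
Proof.
move=> s0 st; rewrite (_ : _ \o _ = (fun x => s^-1%:E * (psi x)%:E) \-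
    (fun x => s^-1%:E * (expR (- (s * ell x)) * psi x)%:E)); last first.
  by apply/funext => x /=; rewrite quotE.
by apply: integrableB => //; apply: integrableZl => //; exact: iexp.
Qed.

Let D s : R := fine (\int[mu]_(x in G) (quot s x)%:E).

Let DE s : (0 < s)%R -> (s <= t0)%R -> \int[mu]_(x in G) (quot s x)%:E = (D s)%:E.
Proof. by move=> s0 st; rewrite fineK//; apply: integrable_fin_num => //; exact: iquot. Qed.

Lemma exp_moment_fin s : (0 < s)%R -> (s <= t0)%R -> exp_moment s = (c - s * D s)%:E.
Proof.
move=> s0 st; have ie := iexp s0 st.
have fe : exp_moment s \is a fin_num by exact: integrable_fin_num.
have : (D s)%:E = s^-1%:E * c%:E - s^-1%:E * exp_moment s.
  rewrite -DE// -intc /exp_moment -integralZl// -[X in _ - X]integralZl//.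
  rewrite -integralB//; [|exact: integrableZl|exact: integrableZl].
  by apply: eq_integral => x _; rewrite quotE.
rewrite -(fineK fe) -!EFinM -EFinB => -[->]; congr (_%:E).
by field; rewrite gt_eqF.
Qed.

(** Removing the integrable minorant [quot t0] from psi ell leaves a nonnegative function, so all
    infinities are confined to its integral. *)
Let gap x := (psi x * ell x - quot t0 x)%R.

Let gap_ge0 x : G x -> (0 <= gap x)%R.
Proof. by move=> Gx; rewrite subr_ge0 ler_wpM2l ?psi0// exp_quot_le. Qed.

Let mgap : measurable_fun G gap.
Proof. by apply: measurable_funB => //; exact: measurable_funM. Qed.

Definition entropy : \bar R := \int[mu]_(x in G) (psi x * ell x)%:E.

Let I : \bar R := \int[mu]_(x in G) (gap x)%:E.

(** Linearity holds even when the entropy is +oo, because b >= 0 keeps the infinite part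
    nonnegative. *)
Lemma integral_affine_entropy a b : (0 <= b)%R ->
  \int[mu]_(x in G) (a * psi x + b * (psi x * ell x))%:E = (a * c)%:E + b%:E * entropy.
Proof.
have affine a' b' : (0 <= b')%R -> \int[mu]_(x in G) (a' * psi x + b' * (psi x * ell x))%:E
    = b'%:E * I + (a' * c + b' * D t0)%:E.
  move=> b0; rewrite (eq_integral (fun x => (b' * gap x)%:E +
      (a' * psi x + b' * quot t0 x)%:E)); last first.
    by move=> x _; rewrite -EFinD /gap; congr (_%:E); ring.
  have ia : mu.-integrable G (fun x => a'%:E * (psi x)%:E) by exact: integrableZl.
  have ib : mu.-integrable G (fun x => b'%:E * (quot t0 x)%:E) by apply: integrableZl => //;
      exact: iquot.
  rewrite integralD_ge0_integrable//; last first.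
  - by have := integrableD mG ia ib.
  - by move=> x Gx; rewrite lee_fin mulr_ge0// gap_ge0.
  - by apply/measurable_EFinP; exact: measurable_funM.
  congr (_ + _).
    under eq_integral do rewrite EFinM.
    rewrite ge0_integralZl//; exact/measurable_EFinP.
  under eq_integral do rewrite EFinD !EFinM.
  rewrite integralD// !integralZl//; last exact: iquot.
  by rewrite intc DE// -!EFinM -EFinD.
move=> b0; rewrite affine//.
have -> : entropy = I + (D t0)%:E.
  have := affine 0%R 1%R ler01; rewrite mul0r add0r mul1r mul1e => <-.
  by apply: eq_integral => x _; rewrite mul0r add0r mul1r.
have I0 : 0 <= I by apply: integral_ge0 => x Gx; rewrite lee_fin gap_ge0.
by rewrite [in RHS]muleDr ?fin_num_adde_defl// -EFinM addeCA -EFinD.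
Qed.

Lemma entropyNy : entropy != -oo.
Proof.
have I0 : 0 <= I by apply: integral_ge0 => x Gx; rewrite lee_fin gap_ge0.
have := integral_affine_entropy 0 (@ler01 R); rewrite mul0r add0e mul1e => <-.
rewrite (eq_integral (fun x => (gap x)%:E + (quot t0 x)%:E)); last first.
  by move=> x _; rewrite -EFinD /gap; congr (_%:E); ring.
rewrite integralD_ge0_integrable//.
- by rewrite DE// -/I; case: I I0.
- exact/measurable_EFinP.
- exact: iquot.
Qed.

Let D_le s : (0 < s)%R -> (s <= t0)%R -> (D s)%:E <= entropy.
Proof.
move=> s0 st; rewrite -DE//.
have e1 : entropy = \int[mu]_(x in G) ((psi x * (ell x - exp_quot s (ell x)))%:E + (quot s x)%:E).
  by apply: eq_integral => x _; rewrite -EFinD /quot; congr (_%:E); ring.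
have g0 x : G x -> 0 <= (psi x * (ell x - exp_quot s (ell x)))%:E.
  by move=> Gx; rewrite lee_fin mulr_ge0 ?psi0// subr_ge0 exp_quot_le.
rewrite e1 integralD_ge0_integrable//; last exact: iquot.
  by rewrite -[leLHS]add0e leeD2r// integral_ge0.
apply/measurable_EFinP; apply: measurable_funM => //; apply: measurable_funB => //.
apply: measurable_funM => //; exact: measurable_funB.
Qed.

Let D_mono s t : (0 < s)%R -> (s <= t)%R -> (t <= t0)%R -> (D t <= D s)%R.
Proof.
move=> s0 st tt; have t_0 := lt_le_trans s0 st; have st0 := le_trans st tt.
rewrite -lee_fin -!DE//; apply: le_integral => //; [exact: iquot|exact: iquot|].
by move=> x /set_mem Gx; rewrite lee_fin ler_wpM2l ?psi0// exp_quot_noninc.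
Qed.

(** Monotone convergence applied after subtracting [quot t0], which makes the sequence
    nonnegative. *)
Let D_cvg : (D k.+1%:R^-1)%:E @[k --> \oo] --> entropy.
Proof.
have k0 k : (0 < k.+1%:R^-1 :> R)%R by rewrite invr_gt0.
have kt k : (k.+1%:R^-1 <= t0)%R by apply: le_trans t01; rewrite invf_le1// ler1n.
pose g k x := (quot k.+1%:R^-1 x - quot t0 x)%:E.
have eE : entropy = I + (D t0)%:E.
  rewrite -DE// -integralD_ge0_integrable//.
  - by apply: eq_integral => x _; rewrite -EFinD /gap; congr (_%:E); ring.
  - exact/measurable_EFinP.
  - exact: iquot.
have gI : \int[mu]_(x in G) g k x @[k --> \oo] --> I.
  rewrite /I (eq_integral (fun x => limn (g ^~ x))); last first.
    move=> x _; apply/esym/cvg_lim => //; apply: cvg_EFin; first exact: nearW.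
    apply: (@cvgB _ _ _ _ _ (fun k => quot k.+1%:R^-1 x) (fun=> quot t0 x)); last exact: cvg_cst.
    apply: (@cvgM _ _ _ _ (fun=> psi x)); first exact: cvg_cst.
    exact: exp_quot_cvg.
  apply: cvg_monotone_convergence => //.
  - by move=> k; apply/measurable_EFinP; exact: measurable_funB.
  - by move=> k x Gx; rewrite lee_fin subr_ge0 ler_wpM2l ?psi0// exp_quot_noninc.
  - move=> x Gx a b ab; rewrite lee_fin lerD2r ler_wpM2l ?psi0// exp_quot_noninc//.
    by rewrite lef_pV2 ?posrE// ler_nat.
rewrite eE (_ : (fun k => _) = (fun k => \int[mu]_(x in G) g k x + (D t0)%:E)).
  by apply: cvgeD => //; [rewrite fin_num_adde_defl|exact: cvg_cst].
apply/funext => k.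
have ig : mu.-integrable G (g k).
  exact: (integrableB mG (iquot (k0 k) (kt k)) (iquot t0pos (lexx _))).
rewrite -!DE// -integralD//; last exact: iquot.
by apply: eq_integral => x _; rewrite -EFinD; congr (_%:E); ring.
Qed.

(** Monotonicity of D carries the limit along s = 1/(k+1) over to all small real s. *)
Let D_gt (M : R) : M%:E < entropy ->
  exists2 delta, (0 < delta <= t0)%R & forall s, (0 < s)%R -> (s <= delta)%R -> (M < D s)%R.
Proof.
move=> Me; have [k Mk] : exists k, M%:E < (D k.+1%:R^-1)%:E.
  apply: contrapT => h; have : entropy <= M%:E.
    apply: (@cvge_to_le _ _ _ _ _ _ _ D_cvg); apply: nearW => k.
    by rewrite leNgt; apply/negP => Mk; apply: h; exists k.
  by rewrite leNgt Me.
exists (k.+1%:R^-1)%R.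
  by rewrite invr_gt0 ltr0n /=; apply: le_trans t01; rewrite invf_le1// ler1n.
move=> s s0 sk; rewrite lte_fin in Mk; apply: lt_le_trans Mk _; apply: D_mono => //.
by apply: le_trans t01; rewrite invf_le1// ler1n.
Qed.

Let near_quot (C N delta : R) : (0 < C)%R -> (0 < delta)%R ->
  \forall p \near +oo%R, [/\ 0 < N + p, 0 < C / (N + p) & C / (N + p) <= delta]%R.
Proof.
move=> C0 d0.
apply: filterS2 (nbhs_pinfty_gt (num_real (- N)%R))
    (nbhs_pinfty_gt (num_real (C / delta - N)%R)) => p h1 h2.
have pN : (0 < N + p)%R by move: h1; lra.
split => //; first exact: divr_gt0.
by rewrite ler_pdivrMr// mulrC -ler_pdivrMr//; move: h2; lra.
Qed.

(** The bounds 1 - 1/Y <= ln Y <= Y - 1, multiplied by q; in the application q s is the constant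
    C. *)
Let powR_bounds (q s Ds : R) (Y := (1 - s * Ds / c)%R) : (0 < q)%R -> (0 <= Y)%R ->
  (Y `^ q <= expR (- (q * s * Ds / c)))%R /\
  ((0 < Y)%R -> (expR (- (q * s * Ds / c / Y)) <= Y `^ q)%R).
Proof.
move=> q0 Y0; have YE : (- (q * s * Ds / c) = q * (Y - 1))%R by rewrite /Y; ring.
split.
  rewrite YE; have [->|Yn0] := eqVneq Y 0%R.
    by rewrite powR0 ?gt_eqF// expR_ge0.
  have Ypos : (0 < Y)%R by rewrite lt_neqAle eq_sym Yn0.
  rewrite /powR (negbTE Yn0) ler_expR ler_pM2l//.
  by have := @le_ln1Dx R (Y - 1) _; rewrite (_ : 1 + (Y - 1) = Y)%R; [apply; lra|ring].
move=> Ypos; rewrite (_ : - _ = q * (1 - Y^-1))%R; last first.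
  have : (- (q * s * Ds / c / Y) = - (q * s * Ds / c) / Y)%R by ring.
  by rewrite YE => ->; field; rewrite gt_eqF.
rewrite /powR gt_eqF// ler_expR ler_pM2l//.
have Yi : (0 < Y^-1)%R by rewrite invr_gt0.
have := @le_ln1Dx R (Y^-1 - 1) _; rewrite (_ : 1 + (Y^-1 - 1) = Y^-1)%R; last ring.
by rewrite lnV ?posrE// => h; have := h ltac:(lra); lra.
Qed.

Let exp_moment_div s : (0 < s)%R -> (s <= t0)%R ->
  exp_moment s / c%:E = (1 - s * D s / c)%:E /\ (0 <= 1 - s * D s / c)%R.
Proof.
move=> s0 st; have e0 : 0 <= exp_moment s.
  by apply: integral_ge0 => x Gx; rewrite lee_fin mulr_ge0 ?expR_ge0 ?psi0.
move: e0; rewrite exp_moment_fin// lee_fin => e0.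
have -> : (1 - s * D s / c = (c - s * D s) / c)%R by field; rewrite gt_eqF.
by rewrite inver gt_eqF// -EFinM divr_ge0// ltW.
Qed.

Lemma exp_moment_power_cvg (C N : R) : (0 < C)%R ->
  poweR (exp_moment (C / (N + p))%R / c%:E) (N + p)%R @[p --> +oo%R]
    --> (if entropy is l%:E then (expR (- (C * l / c)))%:E else 0).
Proof.
move=> C0; pose s p := (C / (N + p))%R.
have near_s delta := @near_quot C N delta C0.
pose Y p := (1 - s p * D (s p) / c)%R.
have powE : \forall p \near +oo%R, (Y p `^ (N + p))%:E = poweR (exp_moment (s p) / c%:E)
    (N + p)%R.
  apply: filterS (near_s t0 t0pos) => p [q0 s0 st].
  by have [-> _] := exp_moment_div s0 st.
have bounds : \forall p \near +oo%R, [/\ (0 <= Y p)%R,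
   (Y p `^ (N + p) <= expR (- (C * D (s p) / c)))%R &
   ((0 < Y p)%R -> (expR (- (C * D (s p) / c / Y p)) <= Y p `^ (N + p))%R)].
  apply: filterS (near_s t0 t0pos) => p [q0 s0 st].
  have [_ Y0] := exp_moment_div s0 st.
  have -> : (C * D (s p) = (N + p) * s p * D (s p))%R.
    by rewrite /s; field; rewrite gt_eqF.
  by have [] := @powR_bounds (N + p)%R (s p) (D (s p)) q0 Y0.
apply: (cvg_trans (near_eq_cvg powE)).
case entE : entropy => [l| |]; last 2 first.
- rewrite (_ : 0 = (0 : R)%:E)//; apply: cvg_EFin; first exact: nearW.
  apply/cvgrPdist_le => e e0.
  (* The value at which exp(- C M / c) = e. *)
  pose M := (- (c / C) * ln e)%R.
  have [|delta /andP[d0 _] dM] := @D_gt M; first by rewrite entE ltry.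
  apply: filterS2 bounds (near_s delta d0) => p [_ h _] [_ s0 sd].
  rewrite sub0r normrN ger0_norm ?powR_ge0//.
  apply: le_trans h _; rewrite -[leRHS]lnK ?posrE// ler_expR.
  have /ltW MD := dM _ s0 sd; rewrite lerNl ler_pdivlMr//.
  have := ler_wpM2l (ltW C0) MD; rewrite /M; apply: le_trans.
  by rewrite le_eqVlt; apply/orP; left; apply/eqP; field; rewrite gt_eqF.
- by have := entropyNy; rewrite entE.
have Dl : D (s p) @[p --> +oo%R] --> l.
  apply/cvgrPdist_le => e e0.
  have [|delta /andP[d0 dt] dM] := @D_gt (l - e)%R; first by rewrite entE lte_fin gtrBl.
  apply: filterS (near_s delta d0) => p [_ s0 sd].
  have h1 := dM _ s0 sd; have := D_le s0 (le_trans sd dt); rewrite entE lee_fin => h2.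
  by rewrite ger0_norm ?subr_ge0// lerBlDr -lerBlDl ltW.
have s_0 : s p @[p --> +oo%R] --> (0%R : R).
  apply/cvgrPdist_le => e e0.
  apply: filterS (near_s e e0) => p [_ s0 se].
  by rewrite sub0r normrN ger0_norm// ltW.
have Y1 : Y p @[p --> +oo%R] --> (1%R : R).
  have -> : (1 = 1 - 0 * l / c)%R by rewrite !mul0r subr0.
  apply: cvgB; first exact: cvg_cst.
  by apply: cvgM; [exact: cvgM|exact: cvg_cst].
have up : expR (- (C * D (s p) / c)) @[p --> +oo%R] --> expR (- (C * l / c)).
  apply: (@continuous_cvg _ _ _ _ _ (fun p => - (C * D (s p) / c))%R expR);
      first exact: continuous_expR.
  apply: cvgN; apply: cvgM; last exact: cvg_cst.
  by apply: cvgM => //; exact: cvg_cst.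
have low : expR (- (C * D (s p) / c / Y p)) @[p --> +oo%R] --> expR (- (C * l / c)).
  rewrite -[X in expR (- X)]divr1.
  apply: (@continuous_cvg _ _ _ _ _ (fun p => - (C * D (s p) / c / Y p))%R expR);
      first exact: continuous_expR.
  apply: cvgN; apply: cvgM; last by apply: cvgV => //; exact: oner_neq0.
  by apply: cvgM; [apply: cvgM => //; exact: cvg_cst|exact: cvg_cst].
apply: cvg_EFin; first exact: nearW.
apply: (squeeze_cvgr _ low up).
have Ypos : \forall p \near +oo%R, (0 < Y p)%R.
  move/cvgrPdist_lt: Y1 => /(_ 1%R ltr01); apply: filterS => p.
  by rewrite ltr_norml => /andP[_]; lra.
by apply: filterS2 bounds Ypos => p [_ h1 h2] Yp; rewrite h1 h2.
Qed.

End ExponentialMoments.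

(** * Relative entropy *)

Section MeasurableReal.
Context d (T : measurableType d) (R : realType) (G : set T).
Implicit Types f g : T -> R.

Lemma measurable_fun_inv_gt0 f : measurable_fun G f ->
  (forall x, G x -> 0 < f x) -> measurable_fun G (fun x => (f x)^-1).
Proof.
move=> mf f0; apply: (eq_measurable_fun (fun x => f x `^ (-1))).
  by move=> x /set_mem Gx; rewrite powR_inv1// ltW// f0.
exact: (measurableT_comp (measurable_powR (-1))).
Qed.

Lemma measurable_fun_extend1 f g : measurable G -> measurable_fun G g ->
  (forall x, G x -> f x = g x) -> (forall x, ~ G x -> f x = 1) ->
  measurable_fun setT f.
Proof.
move=> mG mg fg f1; rewrite -(setUv G); apply/measurable_funU => //; first exact: measurableC.
split; first by apply: (eq_measurable_fun g) => // x /set_mem Gx; rewrite fg.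
apply: (eq_measurable_fun (fun=> 1 : R)); last exact: measurable_cst.
by move=> x /set_mem nG; rewrite f1.
Qed.

End MeasurableReal.

Section RelativeEntropy.
Context d (T : measurableType d) (R : realType) (mu : {measure set T -> \bar R}).
Variables (m : nat) (B G : set T) (kap h ex w : T -> R).
Let e : R := m.+2%:R^-1.
Hypotheses (mG : measurable G) (GB : G `<=` B).
Hypotheses (kap_gt0 : forall x, G x -> 0 < kap x) (kap_off : forall x, B x -> ~ G x -> kap x = 0).
Hypotheses (h_gt0 : forall x, G x -> 0 < h x) (ex0 : forall x, 0 <= ex x).
Hypotheses (exE : forall x, G x -> ex x = kap x `^ e * w x).
Hypotheses (w_off : forall x, ~ G x -> w x = 1) (w0 : forall x, 0 <= w x).
Hypotheses (mkap : measurable_fun G kap) (mh : measurable_fun G h) (mex : measurable_fun G ex).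

Let Om (p : \bar R) : \bar R :=
  (\int[mu]_(x in B) ((kap x `^ e / h x) `^ rel_exponent m.+1 p * ex x)%:E)%E.

Let p x := kap x / (fine (Om +oo%E) * h x ^+ m.+1).
Let q x := h x / fine (Om 0%E).

Hypothesis p1 : with_density mu (fun x => p x * w x) setT = 1%E.
Hypothesis q1 : with_density mu (fun x => q x * w x) setT = 1%E.

Let powkap_gt0 x : G x -> 0 < kap x `^ e. Proof. by move=> Gx; rewrite powR_gt0// kap_gt0. Qed.

Let mpowkap : measurable_fun G (fun x => kap x `^ e).
Proof. exact: (measurableT_comp (measurable_powR e)). Qed.

Let mw : measurable_fun setT w.
Proof.
apply: (measurable_fun_extend1 (g := fun x => ex x * (kap x `^ e)^-1) mG) => //.
  by apply: measurable_funM => //; exact: measurable_fun_inv_gt0.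
by move=> x Gx; rewrite exE// mulrAC divff ?mul1r// gt_eqF// powkap_gt0.
Qed.

Let a x := kap x `^ e / h x.

Let a_gt0 x : G x -> 0 < a x.
Proof. by move=> Gx; rewrite divr_gt0 ?h_gt0// powkap_gt0. Qed.

Let psi x := a x `^ m.+1%:R * ex x.
Let ell x := ln (a x).

Let psi0 x : G x -> 0 <= psi x. Proof. by move=> _; rewrite mulr_ge0 ?powR_ge0. Qed.

Let mhV : measurable_fun G (fun x => (h x)^-1).
Proof. exact: measurable_fun_inv_gt0. Qed.

Let ma : measurable_fun G a. Proof. exact: measurable_funM. Qed.

Let mpsi : measurable_fun G psi.
Proof. by apply: measurable_funM => //; apply: (measurableT_comp (measurable_powR _)). Qed.

Let mell : measurable_fun G ell.
Proof. by apply: (measurableT_comp (@measurable_ln R)). Qed.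

(** Off G the factor in [kap] vanishes only for a nonzero exponent, since 0 to the power 0 is 1. *)
Let OmE b s : rel_exponent m.+1 b != 0 -> rel_exponent m.+1 b = m.+1%:R - s ->
  Om b = exp_moment mu G psi ell s.
Proof.
move=> b0 bs; apply: integral_subset0 => // x.
  move=> Bx nG; rewrite kap_off// powR0 ?mul0r ?powR0 ?mul0r//.
  by rewrite gt_eqF// invr_gt0.
move=> Gx; congr (_%:E); rewrite -/(a x) /psi mulrA; congr (_ * _).
have a0 := a_gt0 Gx; rewrite bs /powR gt_eqF// -expRD; congr expR.
by rewrite /ell; ring.
Qed.

Let psiE x : G x -> psi x = kap x / h x ^+ m.+1 * w x.
Proof.
move=> Gx; have h0 := h_gt0 Gx; have k0 := kap_gt0 Gx.
(* The powers n/(n+1) and 1/(n+1) of kap recombine to kap, the latter coming from [ex]. *)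
have kapE : kap x = (kap x `^ e) `^ m.+1%:R * kap x `^ e.
  rewrite -powRrM -powRD; last by rewrite (gt_eqF k0) implybT.
  by rewrite -[X in _ + X]mulr1 -mulrDr natr1 mulVf ?pnatr_eq0// powRr1// ltW.
rewrite /psi exE// /a powRM ?powR_ge0 ?invr_ge0 ?(ltW h0)//.
rewrite [(h x)^-1 `^ _]powR_mulrn ?invr_ge0 ?(ltW h0)// exprVn.
by rewrite [in RHS]kapE; ring.
Qed.

Let C : R := m.+1%:R * m.+2%:R.

Let rel_exponentE s : m.+1%:R + s != 0 -> rel_exponent m.+1 s%:E = m.+1%:R - C / (m.+1%:R + s).
Proof.
move=> s0; rewrite /rel_exponent /C -[m.+2%:R]natr1.
by move: (m.+1%:R : R) s0 => N s0; field.
Qed.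

Let Om_oo : Om +oo%E = (\int[mu]_(x in G) (psi x)%:E)%E.
Proof.
rewrite (@OmE _ 0) ?subr0 ?pnatr_eq0//.
by apply: eq_integral => x _; rewrite mul0r oppr0 expR0 mul1r.
Qed.

Let Om_0 : Om 0%E = exp_moment mu G psi ell m.+2%:R.
Proof.
have E : rel_exponent m.+1 0%E = m.+1%:R - m.+2%:R :> R.
  rewrite rel_exponentE addr0 ?pnatr_eq0// /C mulrAC divff ?mul1r ?pnatr_eq0//.
apply: OmE => //; rewrite E -[m.+2%:R]natr1 opprD addrA subrr sub0r.
by rewrite oppr_eq0 oner_eq0.
Qed.

Let Om_ge0 s : (0 <= Om s)%E.
Proof. by apply: integral_ge0 => x _; rewrite lee_fin mulr_ge0// powR_ge0. Qed.

(** [fine] maps infinite values to 0, and division by 0 gives 0; so if [Om s] were 0 or infinite,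
    the density would vanish and could not have mass 1. *)
Let fine_neq0 s f : (forall x, fine (Om s) = 0 -> f x = 0) ->
  with_density mu (fun x => f x * w x) setT = 1%E -> exists2 c : R, 0 < c & Om s = c%:E.
Proof.
move=> f0 f1; have : fine (Om s) != 0.
  apply/eqP => s0; move: f1; rewrite /with_density.
  rewrite integral0_eq => [/eqP|x _]; first by rewrite eq_sym onee_eq0.
  by rewrite f0// mul0r.
have := Om_ge0 s; case: (Om s) => [c| |] //=; last by rewrite eqxx.
by rewrite lee_fin le_eqVlt eq_sym => /orP[->//|c0] _; exists c.
Qed.

Lemma KL_relative_entropy : KL (with_density mu w) B p q
  = lne (Om 0 / Om +oo * epow (lim (poweR (Om s%:E / Om +oo) (m.+1%:R + s) @[s --> +oo%R]))
      (- m.+1%:R^-1))%E.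
Proof.
have [c c_gt0 cE] : exists2 c : R, 0 < c & Om +oo%E = c%:E.
  by apply: fine_neq0 p1 => x z; rewrite /p z mul0r invr0 mulr0.
have [c0 c0_gt0 c0E] : exists2 c : R, 0 < c & Om 0%E = c%:E.
  by apply: fine_neq0 q1 => x z; rewrite /q z invr0 mulr0.
have intc : (\int[mu]_(x in G) (psi x)%:E = c%:E)%E by rewrite -Om_oo.
have intc0 : exp_moment mu G psi ell m.+2%:R = c0%:E by rewrite -Om_0.
have t1 : 1 <= m.+2%:R :> R by rewrite ler1n.
have C_gt0 : 0 < C by rewrite mulr_gt0.
have nC : m.+1%:R != 0 :> R by rewrite pnatr_eq0.
set ent := entropy mu G psi ell.
have entE := integral_affine_entropy mG mpsi mell psi0 t1 intc intc0.
have entN := entropyNy mG mpsi mell psi0 t1 intc intc0.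
have lim_E := exp_moment_power_cvg mG mpsi mell psi0 t1 c_gt0 intc intc0 m.+1%:R C_gt0.
have -> : lim (poweR (Om s%:E / Om +oo) (m.+1%:R + s) @[s --> +oo%R])%E
   = (if ent is l%:E then (expR (- (C * l / c)))%:E else 0)%E.
  apply/cvg_lim => //; apply: cvg_trans lim_E; apply: near_eq_cvg.
  (* For s > 1 the exponent n (s - 1) / (n + s) is positive, as [OmE] requires. *)
  apply: filterS (nbhs_pinfty_gt (num_real (1 : R))) => s s1.
  have n0 : 0 < m.+1%:R :> R by [].
  have sn : 0 < m.+1%:R + s by lra.
  rewrite (@OmE _ (C / (m.+1%:R + s))) ?cE ?rel_exponentE ?gt_eqF//.
  by rewrite -rel_exponentE ?gt_eqF// divr_gt0 ?mulr_gt0 ?subr_gt0.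
have KLE : KL (with_density mu w) B p q = ((ln (c0 / c))%:E + (m.+2%:R / c)%:E * ent)%E.
  have lnpq x : G x -> lne ((p x)%:E / (q x)%:E) = (ln (c0 / c) + m.+2%:R * ell x)%:E.
    move=> Gx; have h0 := h_gt0 Gx; have k0 := kap_gt0 Gx.
    have q0 : 0 < q x by rewrite divr_gt0// c0E.
    have p0 : 0 < p x by rewrite divr_gt0// mulr_gt0 ?exprn_gt0// cE.
    rewrite inver gt_eqF// -EFinM lne_EFin; last exact: divr_gt0.
    congr (_%:E).
    (* The second factor is a^(n+1), which is where the coefficient n+1 of ell comes from. *)
    have -> : p x / q x = (c0 / c) * (kap x / h x ^+ m.+2).
      rewrite /p /q cE c0E [h x ^+ m.+2]exprS /=.
      move: (h x ^+ m.+1) (exprn_gt0 m.+1 h0) => H H0.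
      by field; rewrite !gt_eqF.
    rewrite lnM ?posrE ?divr_gt0 ?exprn_gt0//; congr (_ + _).
    rewrite /ell /a !ln_div ?posrE ?exprn_gt0 ?powkap_gt0// ln_powR lnXn// mulrBr mulrA.
    by rewrite mulfV ?pnatr_eq0// mul1r mulr_natl.
  have -> : KL (with_density mu w) B p q =
      (\int[with_density mu w]_(x in G) (p x * (ln (c0 / c) + m.+2%:R * ell x))%:E)%E.
    apply: integral_subset0 => // x; first by move=> Bx nG; rewrite /p kap_off// mul0r mul0e.
    by move=> Gx; rewrite lnpq.
  rewrite integral_density//; last first.
    apply: measurable_funM.
      apply: measurable_funM => //; apply: measurable_fun_inv_gt0.
        by apply: measurable_funM => //; exact: measurable_funX.
      by move=> x Gx; rewrite mulr_gt0 ?cE// exprn_gt0// h_gt0.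
    by apply: measurable_funD => //; exact: measurable_funM.
  transitivity (\int[mu]_(x in G) ((ln (c0 / c) / c) * psi x + (m.+2%:R / c) *
      (psi x * ell x))%:E)%E.
    apply: eq_integral => x /set_mem Gx; congr (_%:E).
    have h0 := h_gt0 Gx; have k0 := kap_gt0 Gx.
    rewrite psiE//.
    rewrite /p cE /=; move: (h x ^+ m.+1) (exprn_gt0 m.+1 h0) => H H0.
    by field; rewrite !gt_eqF.
  rewrite entE ?divr_ge0 ?(ltW c_gt0)//; congr ((_)%:E + _)%E.
  by field; rewrite gt_eqF.
rewrite KLE cE c0E inver gt_eqF// -EFinM /epow oppr_lt0 invr_gt0 ltr0n /= opprK.
case entC : ent => [l| |].
- rewrite /= -expRM inver gt_eqF ?expR_gt0// -EFinM lne_EFin; last first.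
    by rewrite mulr_gt0 ?divr_gt0// invr_gt0 expR_gt0.
  rewrite -EFinD [in RHS]ln_div ?posrE ?divr_gt0 ?expR_gt0// expRK; congr (_ + _)%:E.
  rewrite /C; move: nC; move: (m.+1%:R : R) (m.+2%:R : R) => N M N0.
  by field; rewrite N0 gt_eqF.
(* Infinite entropy: E^R(K) = 0, its negative power is +oo under [epow], and both sides are +oo. *)
- rewrite /= powR0 ?invr_eq0// inve0 gt0_muley ?lte_fin ?divr_gt0//.
  by rewrite gt0_muley ?lte_fin ?divr_gt0.
- by move: entN; rewrite -/ent entC.
Qed.

End RelativeEntropy.

Lemma powR_prod {R : realType} (I : Type) (s : seq I) (k : I -> R) (e : R) :
  (forall i, 0 <= k i) -> \prod_(i <- s) k i `^ e = (\prod_(i <- s) k i) `^ e.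
Proof.
move=> k0; elim: s => [|i s IH]; first by rewrite !big_nil powR1.
by rewrite !big_cons IH powRM// prodr_ge0.
Qed.

Lemma measurable_det d (T : measurableType d) (R : realType) (D : set T) m (A : T -> 'M[R]_m) :
  (forall i j, measurable_fun D (fun x => A x i j)) -> measurable_fun D (fun x => \det (A x)).
Proof.
move=> mA; rewrite /determinant; apply: measurable_sum => s.
apply: measurable_funM => //; apply: measurable_prod => i _; exact: mA.
Qed.

Lemma gauss_curvature_not_smooth {R : realType} {m : nat} (K : set 'rV[R]_m.+1) (r lam : R) x :
  compact K -> interior K 0 -> 0 < r -> ball_convex r K -> boundary K x ->
  ~ smooth K lam x -> gauss_curvature K x = 0.
Proof.
move=> cK K0 r0 bK Bx nG; rewrite /gauss_curvature /kappa_
    (principal_curvatures_not_smooth K0 nG).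
case: m K x cK K0 bK nG Bx => [|m] K x cK K0 bK nG Bx; last by rewrite big_ord_recl mxE mul0r.
(* For n = 1 the empty product is 1, but every boundary point is
   smooth. *)
by exfalso; apply: nG; exact: (boundary_smooth1 lam cK K0 r0 bK Bx).
Qed.

(** * Application to ball-convex bodies *)

Section BallConvex.
Context {R : realType} {m : nat}.
Variables (r : R) (K : set 'rV[R]_m.+1).
Hypotheses (r0 : 0 < r) (cK : compact K) (K0 : interior K 0) (bK : ball_convex r K).
Let T := surface_type K.
Implicit Types x : T.

(* Any lam > 1/r would do; this choice makes lam - 1/r = 1. *)
Let lam : R := r^-1 + 1.
Let G : set T := smooth K lam.
Let mu := surface_measure K.
Let kap x : R := gauss_curvature K x.
Let h x : R := dot (x : 'rV[R]_m.+1) (outer_normal K x).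
Let e : R := m.+2%:R^-1.
Let excess x : R := \prod_(i < m) (kappa_ K x i - r^-1) `^ e.

Let lam0 : 0 < lam. Proof. by rewrite addr_gt0// invr_gt0. Qed.

Let mG : measurable G. Proof. exact: smooth_measurable. Qed.

Let GB : G `<=` boundary K. Proof. by move=> x; exact: smooth_boundary. Qed.

Let kappa_ge x i : G x -> r^-1 <= kappa_ K x i.
Proof. by move=> Gx; have [] := smooth_principal_curvatures cK K0 r0 bK Gx. Qed.

Let kappa_gt0 x i : G x -> 0 < kappa_ K x i.
Proof. by move=> Gx; apply: lt_le_trans (kappa_ge i Gx); rewrite invr_gt0. Qed.

Let kap_gt0 x : G x -> 0 < kap x.
Proof. by move=> Gx; apply: prodr_gt0 => i _; exact: kappa_gt0. Qed.

Let h_gt0 x : G x -> 0 < h x.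
Proof. by move=> Gx; exact: smooth_support Gx. Qed.

Let kapE x : G x -> kap x = lam^-1 * \det (shape_mx K lam x).
Proof.
move=> Gx; have [_ /(_ 0)] := smooth_principal_curvatures cK K0 r0 bK Gx.
have z : (0%:M : 'M[R]_m.+1) = 0 by rewrite raddf0.
rewrite z !subr0 => <-.
under eq_bigr do rewrite subr0.
by rewrite mulKf// gt_eqF.
Qed.

Let excessE x : G x -> excess x = (\det (shape_mx K lam x - r^-1%:M)) `^ e.
Proof.
move=> Gx; have [_ /(_ r^-1)] := smooth_principal_curvatures cK K0 r0 bK Gx.
rewrite (_ : lam - r^-1 = 1) ?mul1r => [<-|]; last by rewrite /lam addrAC subrr add0r.
by rewrite -powR_prod// => i; rewrite subr_ge0; exact: kappa_ge.
Qed.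

Let excess_weight x : G x -> excess x = kap x `^ e * weight_w r K x.
Proof.
move=> Gx; rewrite /kap /gauss_curvature -powR_prod; last by move=> i; exact/ltW/kappa_gt0.
rewrite /weight_w -big_split /=; apply: eq_bigr => i _.
have ki := kappa_gt0 i Gx; have rk : 0 < r * kappa_ K x i by rewrite mulr_gt0.
have wi : 0 <= 1 - (r * kappa_ K x i)^-1.
  by rewrite subr_ge0 invf_le1// -ler_pdivrMl// mulr1 kappa_ge.
rewrite -powRM// ?(ltW ki)//.
by congr (_ `^ _); field; rewrite !gt_eqF.
Qed.

Let weight_not_smooth x : ~ G x -> weight_w r K x = 1.
Proof.
move=> nG; rewrite /weight_w big1// => i _.
by rewrite /kappa_ (principal_curvatures_not_smooth K0 nG) mxE mulr0 invr0 subr0 powR1.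
Qed.

Let kap_not_smooth x : boundary K x -> ~ G x -> kap x = 0.
Proof. exact: (gauss_curvature_not_smooth cK K0 r0 bK). Qed.

Let mdet c : measurable_fun G (fun x : T => \det (shape_mx K lam x - c%:M)).
Proof.
apply: measurable_det => i j.
rewrite (_ : (fun x => _) = (fun x : T => shape_mx K lam x i j - (c%:M : 'M[R]_m.+1) i j));
    last first.
  by apply/funext => x; rewrite !mxE.
by apply: measurable_funB; [exact: shape_mx_measurable|exact: measurable_cst].
Qed.

Let mkap : measurable_fun G kap.
Proof.
apply: (eq_measurable_fun (fun x : T => lam^-1 * \det (shape_mx K lam x - 0%:M))).
  by move=> x /set_mem Gx; rewrite kapE// raddf0 subr0.
by apply: measurable_funM.
Qed.

Let mexcess : measurable_fun G excess.
Proof.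
apply: (eq_measurable_fun (fun x : T => (\det (shape_mx K lam x - r^-1%:M)) `^ e)).
  by move=> x /set_mem Gx; rewrite excessE.
by apply: (measurableT_comp (measurable_powR e)).
Qed.

Let mh : measurable_fun G h.
Proof.
apply: (eq_measurable_fun (fun x : T => - - h x)) => [x _|]; first by rewrite opprK.
(* The sets {h <= c} are the available ones; for -h their complements are strict sublevel sets. *)
apply: measurable_funN; apply: measurable_fun_lt => b.
rewrite (_ : _ `&` _ = G `\` [set x | exists2 u, regular K x u & dot x u <= - b]).
  by apply: (measurableD mG); exact: support_measurable.
apply/seteqP; split => x [Gx /=].
  move=> hb; split; first exact: Gx.
  move=> [u xu]; have := hb; rewrite /h (outer_normal_regular xu); lra.
move=> nb; split; first exact: Gx.
rewrite ltNge; apply/negP => bh; apply: nb.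
exists (outer_normal K x); first exact: smooth_regular Gx.
by move: bh; rewrite /h; lra.
Qed.

Let w0 x : 0 <= weight_w r K x.
Proof. by apply: prodr_ge0 => i _; exact: powR_ge0. Qed.

Let excess0 x : 0 <= excess x.
Proof. by apply: prodr_ge0 => i _; exact: powR_ge0. Qed.

Lemma KL_ball_convex :
  with_density mu (fun x => dens_p r K x * weight_w r K x) setT = 1%E ->
  with_density mu (fun x => dens_q r K x * weight_w r K x) setT = 1%E ->
  KL (with_density mu (weight_w r K)) (boundary K) (dens_p r K) (dens_q r K)
  = lne (Omega r K 0 / Omega r K +oo * epow (rel_E r K) (- m.+1%:R^-1))%E.
Proof.
exact: (KL_relative_entropy mG GB kap_gt0 kap_not_smooth h_gt0 excess0 excess_weight
  weight_not_smooth w0 mkap mh mexcess).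
Qed.

End BallConvex.

Theorem proposition8 (R : realType) (n : nat) (r : R) (K : set 'rV[R]_n)
  (P Q : probability (surface_type K) R) :
  (0 < n)%N -> 0 < r ->
  convex_body K -> ball_convex r K -> interior K 0 ->
  (0 < surface_measure K
         [set x | boundary K x /\ forall i : 'I_n.-1, (r^-1 < kappa_ K x i)%R])%E ->
  (forall A : set (surface_type K), measurable A ->
     P A = with_density (surface_measure K)
             (fun x => dens_p r K x * weight_w r K x) A) ->
  (forall A : set (surface_type K), measurable A ->
     Q A = with_density (surface_measure K)
             (fun x => dens_q r K x * weight_w r K x) A) ->
  KL (with_density (surface_measure K) (weight_w r K))
     (boundary K) (dens_p r K) (dens_q r K)
  = lne (Omega r K 0 / Omega r K +oo * epow (rel_E r K) (- n%:R^-1))%E.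
Proof.
case: n K P Q => // m K P Q _ r0 [cK _ _] bK K0 _ hP hQ.
(* Evaluating P and Q on the whole space gives the two normalizations. *)
by apply: KL_ball_convex => //; [rewrite -hP|rewrite -hQ] => //; exact: probability_setT.
Qed.
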